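(* Let $\mathcal T$ be a proper $\mathbb K$-linear triangulated category which has an enhancement, let $\sigma\in\mathrm{Stab}(\mathcal T)$, and let $\mathcal E=(E_0,\dots,E_n)$ be a full $\sigma$-exceptional collection in $\mathcal T$. (i) If $\phi_\sigma(E_{i-1})<\phi_\sigma(E_i)$ for all $i=1,\dots,n$, then $C_{D^b(pt),\sigma\sigma}(\mathcal T)=\{\langle E_0\rangle,\langle E_1\rangle,\dots,\langle E_n\rangle\}$. In particular $C_{l,\sigma\sigma}(\mathcal T)=C_{l,\sigma}(\mathcal T)=\emptyset$ for all $l\ge 0$. (ii) If for some $0\le i<n$ and some $l\ge 0$ we have $\hom^1(E_i,E_{i+1})=l+1$, $\hom^j(E_i,E_{i+1})=0$ for all $j\in\mathbb Z\setminus\{1\}$, and $\phi_\sigma(E_i)\ge\phi_\sigma(E_{i+1})$, then $\langle E_i,E_{i+1}\rangle\in C_{l,\sigma\sigma}(\mathcal T)$.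
   Context: $\mathbb K$ is a field. For objects $X,Y$ of a $\mathbb K$-linear triangulated category, $\hom^i(X,Y)=\dim_{\mathbb K}\mathrm{Hom}(X,Y[i])$; $\mathcal T$ is proper if $\sum_i\hom^i(X,Y)<\infty$ for all $X,Y$; ''has an enhancement'' means it has a dg-enhancement. $\langle S\rangle$ is the (full) triangulated subcategory generated by $S$. An object $E$ is exceptional if $\mathrm{Hom}(E,E)=\mathbb K$ and $\mathrm{Hom}(E,E[i])=0$ for $i\ne0$. An exceptional collection is a sequence $(E_0,\dots,E_n)$ of exceptional objects with $\hom^i(E_a,E_b)=0$ for all $i\in\mathbb Z$, $a>b$; it is full if it generates $\mathcal T$, and strong if $\hom^k(E_a,E_b)=0$ for all $a,b$ and $k\ne0$. $\mathrm{Stab}(\mathcal T)$ is Bridgeland's manifold of locally finite stability conditions; for $\sigma\in\mathrm{Stab}(\mathcal T)$, $\sigma^{ss}$ is the set of $\sigma$-semistable objects and $\phi_\sigma(X)$ is the phase of $X\in\sigma^{ss}$. An exceptional collection $(E_0,\dots,E_n)$ is $\sigma$-exceptional if: all $E_i\in\sigma^{ss}$; $\hom^{k}(E_i,E_j)=0$ for all $i\neq j$ and $k\le 0$; and there is $t\in\mathbb R$ with $\phi_\sigma(E_i)\in(t,t+1]$ for all $i$. Derived points: $C_{D^b(pt),\mathbb K}(\mathcal T)$ is the set of subcategories $\langle E\rangle\subset\mathcal T$ with $E$ exceptional, and $C_{D^b(pt),\sigma\sigma}(\mathcal T)=\{\langle E\rangle\in C_{D^b(pt),\mathbb K}(\mathcal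 T):E\in\sigma^{ss}\}$. For $l\ge-1$, the set $C_l(\mathcal T)$ of non-commutative curves of genus $l$ is the set of full triangulated subcategories $\mathcal A=\langle E_0,E_1\rangle\subset\mathcal T$ for some strong exceptional pair $(E_0,E_1)$ with $\hom(E_0,E_1)=l+1$. $C_{l,\sigma\sigma}(\mathcal T)$ (the $\sigma$-stable curves) is the set of $\mathcal A\in C_l(\mathcal T)$ such that every exceptional object of $\mathcal A$ is in $\sigma^{ss}$; $C_{l,\sigma}(\mathcal T)$ (the $\sigma$-semistable curves) is the set of $\mathcal A\in C_l(\mathcal T)$ such that infinitely many derived points of $\mathcal A$ lie in $C_{D^b(pt),\sigma\sigma}(\mathcal T)$. *)

(* Defs.v *)
From HB Require Import structures.
From mathcomp Require Import all_boot all_order all_algebra.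
From mathcomp Require Import all_classical all_reals all_analysis.
From mathcomp Require Import complex.

Set Implicit Arguments.
Unset Strict Implicit.
Unset Printing Implicit Defensive.

Import Order.TTheory GRing.Theory Num.Theory.

Local Open Scope classical_set_scope.
Local Open Scope ring_scope.

Record linCat (K : fieldType) := LinCat {
  obj :> Type;
  mor : obj -> obj -> lmodType K;
  idm : forall X, mor X X;
  mcomp : forall X Y Z, mor Y Z -> mor X Y -> mor X Z;
  comp1m : forall X Y (f : mor X Y), mcomp (idm Y) f = f;
  compm1 : forall X Y (f : mor X Y), mcomp f (idm X) = f;
  compA : forall X Y Z W (h : mor Z W) (g : mor Y Z) (f : mor X Y),
    mcomp h (mcomp g f) = mcomp (mcomp h g) f;
  comp_linl : forall X Y Z (f : mor X Y), linear (fun g : mor Y Z => mcomp g f);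
  comp_linr : forall X Y Z (g : mor Y Z), linear (fun f : mor X Y => mcomp g f)
}.
Arguments mor {K l}.
Arguments idm {K l}.
Arguments mcomp {K l X Y Z}.

Notation "g \oc f" := (mcomp g f) (at level 45, right associativity).

Section LinCat.
Context {K : fieldType} {C : linCat K}.
Implicit Types X Y Z W : C.

Definition is_iso X Y (f : mor X Y) : Prop :=
  exists g : mor Y X, g \oc f = idm X /\ f \oc g = idm Y.

Definition isom X Y : Prop := exists f : mor X Y, is_iso f.

Definition is_zero X : Prop := idm X = 0.

Definition is_biproduct X Y W : Prop :=
  exists (i1 : mor X W) (i2 : mor Y W) (p1 : mor W X) (p2 : mor W Y),
    [/\ p1 \oc i1 = idm X, p2 \oc i2 = idm Y, p1 \oc i2 = 0, p2 \oc i1 = 0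
      & i1 \oc p1 + i2 \oc p2 = idm W].

Definition is_kernel (A : set C) X Y Z (f : mor X Y) (c : mor Y Z) : Prop :=
  c \oc f = 0 /\
  forall W (g : mor W Y), A W -> c \oc g = 0 -> exists! h : mor W X, f \oc h = g.

Definition is_cokernel (A : set C) X Y Z (f : mor X Y) (c : mor Y Z) : Prop :=
  c \oc f = 0 /\
  forall W (g : mor Y W), A W -> g \oc f = 0 -> exists! h : mor Z W, h \oc c = g.

(** A strict monomorphism of [A]: the canonical map from its source (its
    coimage) to its image, the kernel of its cokernel, is an isomorphism. *)
Definition strict_mono (A : set C) X Y (f : mor X Y) : Prop :=
  exists Z (c : mor Y Z), [/\ A Z, is_cokernel A f c & is_kernel A f c].

Definition artinian (A : set C) : Prop :=
  forall X (Y : nat -> C) (m : forall k, mor (Y k) X)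
         (c : forall k, mor (Y k.+1) (Y k)),
    A X -> (forall k, A (Y k)) -> (forall k, strict_mono A (m k)) ->
    (forall k, m k \oc c k = m k.+1) ->
    exists N, forall k, (N <= k)%N -> is_iso (c k).

Definition noetherian (A : set C) : Prop :=
  forall X (Y : nat -> C) (m : forall k, mor (Y k) X)
         (c : forall k, mor (Y k) (Y k.+1)),
    A X -> (forall k, A (Y k)) -> (forall k, strict_mono A (m k)) ->
    (forall k, m k.+1 \oc c k = m k) ->
    exists N, forall k, (N <= k)%N -> is_iso (c k).

Definition finite_length (A : set C) : Prop := artinian A /\ noetherian A.

End LinCat.

(** The shift is an autoequivalence with a chosen quasi-inverse. *)
Record shiftCat (K : fieldType) := ShiftCat {
  cat :> linCat K;
  has_zero : exists Z : cat, is_zero Z;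
  has_biproducts : forall X Y : cat, exists W, is_biproduct X Y W;
  sh : cat -> cat;
  shm : forall X Y : cat, mor X Y -> mor (sh X) (sh Y);
  shm_id : forall X : cat, shm (idm X) = idm (sh X);
  shm_comp : forall (X Y Z : cat) (g : mor Y Z) (f : mor X Y),
    shm (g \oc f) = shm g \oc shm f;
  shm_lin : forall X Y : cat, linear (@shm X Y);
  shi : cat -> cat;
  shim : forall X Y : cat, mor X Y -> mor (shi X) (shi Y);
  shim_id : forall X : cat, shim (idm X) = idm (shi X);
  shim_comp : forall (X Y Z : cat) (g : mor Y Z) (f : mor X Y),
    shim (g \oc f) = shim g \oc shim f;
  shim_lin : forall X Y : cat, linear (@shim X Y);
  sh_unit : forall X : cat, mor X (shi (sh X));
  sh_unit_iso : forall X : cat, is_iso (sh_unit X);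
  sh_unit_nat : forall (X Y : cat) (f : mor X Y),
    shim (shm f) \oc sh_unit X = sh_unit Y \oc f;
  sh_counit : forall X : cat, mor (sh (shi X)) X;
  sh_counit_iso : forall X : cat, is_iso (sh_counit X);
  sh_counit_nat : forall (X Y : cat) (f : mor X Y),
    f \oc sh_counit X = sh_counit Y \oc shm (shim f)
}.
Arguments sh {K s}.
Arguments shm {K s X Y}.
Arguments shi {K s}.

Record triCat (K : fieldType) := TriCat {
  tcat :> shiftCat K;
  distinguished : forall X Y Z : tcat, mor X Y -> mor Y Z -> mor Z (sh X) -> Prop;
  tr1_id : forall X Z : tcat, is_zero Z ->
    distinguished (idm X) (0 : mor X Z) (0 : mor Z (sh X));
  tr1_iso : forall (X Y Z X' Y' Z' : tcat)
      (f : mor X Y) (g : mor Y Z) (h : mor Z (sh X))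
      (f' : mor X' Y') (g' : mor Y' Z') (h' : mor Z' (sh X'))
      (a : mor X X') (b : mor Y Y') (c : mor Z Z'),
    is_iso a -> is_iso b -> is_iso c ->
    b \oc f = f' \oc a -> c \oc g = g' \oc b -> shm a \oc h = h' \oc c ->
    distinguished f g h -> distinguished f' g' h';
  tr1_cone : forall (X Y : tcat) (f : mor X Y),
    exists Z (g : mor Y Z) (h : mor Z (sh X)), distinguished f g h;
  tr2 : forall (X Y Z : tcat) (f : mor X Y) (g : mor Y Z) (h : mor Z (sh X)),
    distinguished f g h <-> distinguished g h (- shm f);
  tr3 : forall (X Y Z X' Y' Z' : tcat)
      (f : mor X Y) (g : mor Y Z) (h : mor Z (sh X))
      (f' : mor X' Y') (g' : mor Y' Z') (h' : mor Z' (sh X'))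
      (a : mor X X') (b : mor Y Y'),
    distinguished f g h -> distinguished f' g' h' -> b \oc f = f' \oc a ->
    exists c : mor Z Z', c \oc g = g' \oc b /\ shm a \oc h = h' \oc c;
  tr4 : forall (X Y Z A B C : tcat) (f : mor X Y) (g : mor Y Z)
      (f1 : mor Y A) (f2 : mor A (sh X))
      (g1 : mor Z B) (g2 : mor B (sh Y))
      (h1 : mor Z C) (h2 : mor C (sh X)),
    distinguished f f1 f2 -> distinguished g g1 g2 -> distinguished (g \oc f) h1 h2 ->
    exists (u : mor A C) (v : mor C B),
      [/\ distinguished u v (shm f1 \oc g2),
          u \oc f1 = h1 \oc g, h2 \oc u = f2,
          v \oc h1 = g1 & g2 \oc v = shm f \oc h2]
}.
Arguments distinguished {K t X Y Z}.

Section Triangulated.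
Context {K : fieldType} {T : triCat K}.
Implicit Types X Y Z : T.

Definition shift_obj X (i : int) : T :=
  match i with Posz n => iter n sh X | Negz n => iter n.+1 shi X end.

(** [homdim i X Y d] : the space Hom(X,Y[i]) has (finite) dimension [d]. *)
Definition homdim (i : int) X Y (d : nat) : Prop :=
  inhabited (Vector.axiom d (mor X (shift_obj Y i))).

(** A full subcategory is a set of objects; subcategories are taken strict
    (closed under isomorphism), so that equality of subcategories is equality
    of sets of objects. *)
Definition triangulated_sub (A : set T) : Prop :=
  [/\ forall X, is_zero X -> A X,
      forall X Y, isom X Y -> A X -> A Y,
      forall X, A X -> A (sh X),
      forall X, A X -> A (shi X)
    & forall X Y Z (f : mor X Y) (g : mor Y Z) (h : mor Z (sh X)),
        distinguished f g h -> A X -> A Y -> A Z].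

Definition generated (S : set T) : set T := smallest triangulated_sub S.

Definition extension_closed (A : set T) : Prop :=
  [/\ forall X, is_zero X -> A X,
      forall X Y, isom X Y -> A X -> A Y
    & forall X Y Z (f : mor X Y) (g : mor Y Z) (h : mor Z (sh X)),
        distinguished f g h -> A X -> A Z -> A Y].

End Triangulated.

Definition proper_cat (K : fieldType) (T : triCat K) : Prop :=
  forall X Y : T,
    (forall i, exists d, homdim i X Y d) /\
    (exists N : nat, forall i : int, (N < `|i|)%N -> homdim i X Y 0).

(** Cohomological grading.  The degree equations are arguments of the
    differential and of the composition, so that no transport along equalities
    of integers is needed in the axioms. *)
Record dgCat (K : fieldType) := DgCat {
  dgobj :> Type;
  dghom : dgobj -> dgobj -> int -> lmodType K;
  dgd : forall X Y (n m : int), n + 1 = m -> dghom X Y n -> dghom X Y m;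
  dgid : forall X, dghom X X 0;
  dgcomp : forall X Y Z (m n k : int), m + n = k ->
    dghom Y Z m -> dghom X Y n -> dghom X Z k;
  dgd_lin : forall X Y n m (e : n + 1 = m), linear (@dgd X Y n m e);
  dgcomp_linl : forall X Y Z m n k (e : m + n = k) (f : dghom X Y n),
    linear (fun g : dghom Y Z m => dgcomp e g f);
  dgcomp_linr : forall X Y Z m n k (e : m + n = k) (g : dghom Y Z m),
    linear (fun f : dghom X Y n => dgcomp e g f);
  dgcomp1m : forall X Y n (e : 0 + n = n) (f : dghom X Y n),
    dgcomp e (dgid Y) f = f;
  dgcompm1 : forall X Y n (e : n + 0 = n) (f : dghom X Y n),
    dgcomp e f (dgid X) = f;
  dgcompA : forall X Y Z W (l m n lm mn k : int)
      (e1 : m + n = mn) (e2 : l + mn = k) (e3 : l + m = lm) (e4 : lm + n = k)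
      (h : dghom Z W l) (g : dghom Y Z m) (f : dghom X Y n),
    dgcomp e2 h (dgcomp e1 g f) = dgcomp e4 (dgcomp e3 h g) f;
  dgd_sq : forall X Y n m k (e1 : n + 1 = m) (e2 : m + 1 = k) (f : dghom X Y n),
    dgd e2 (dgd e1 f) = 0;
  dgd_comp : forall X Y Z (m n k m1 n1 k1 : int)
      (e : m + n = k) (em : m + 1 = m1) (en : n + 1 = n1) (ek : k + 1 = k1)
      (e1 : m1 + n = k1) (e2 : m + n1 = k1) (g : dghom Y Z m) (f : dghom X Y n),
    dgd ek (dgcomp e g f) =
      dgcomp e1 (dgd em g) f + (-1) ^ m *: dgcomp e2 g (dgd en f)
}.
Arguments dghom {K d}.
Arguments dgd {K d X Y n m}.
Arguments dgid {K d}.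
Arguments dgcomp {K d X Y Z m n k}.

Section DgCat.
Context {K : fieldType} {A : dgCat K}.
Implicit Types X Y Z W : A.

Definition dgclosed X Y n (f : dghom X Y n) : Prop :=
  forall m (e : n + 1 = m), dgd e f = 0.

Definition dgexact X Y n (f : dghom X Y n) : Prop :=
  exists m (e : m + 1 = n) (h : dghom X Y m), dgd e h = f.

(** [u] and [v] are mutually inverse closed homotopy equivalences between [X']
    and the formal shift X[k], where Hom^n(X[k],X') is Hom^(n-k)(X,X'). *)
Definition shift_equiv X X' (k : int)
    (u : dghom X X' (- k)) (v : dghom X' X k) : Prop :=
  [/\ dgclosed u, dgclosed v,
      dgexact (dgcomp (subrr k) v u - dgid X)
    & dgexact (dgcomp (addNr k) u v - dgid X')].

(** For closed f : X -> Y of degree 0, the cone of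
    f o - : Hom(W,X) -> Hom(W,Y) is Hom^(n+1)(W,X) (+) Hom^n(W,Y) in degree n,
    with d(x, y) = (- dx, f x + dy). *)
Definition cone_closed X Y (f : dghom X Y 0) W n m (e : n + 1 = m)
    (x : dghom W X m) (y : dghom W Y n) : Prop :=
  dgclosed x /\ dgcomp (add0r m) f x + dgd e y = 0.

Definition cone_exact X Y (f : dghom X Y 0) W n m
    (x : dghom W X m) (y : dghom W Y n) : Prop :=
  exists k (e0 : k + 1 = n) (e : n + 1 = m)
         (x' : dghom W X n) (y' : dghom W Y k),
    x = - dgd e x' /\ y = dgcomp (add0r n) f x' + dgd e0 y'.

(** (p, s) is a closed degree 0 morphism from the module represented by [Z] to
    the cone of f_*, the cone of the representable modules of [X] and [Y], and
    it is a quasi-isomorphism: [Z] represents the cone of [f] in D(A). *)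
Definition is_dgcone X Y Z (f : dghom X Y 0)
    (p : dghom Z X 1) (s : dghom Z Y 0) : Prop :=
  [/\ dgclosed p,
      dgd (add0r 1) s = - dgcomp (add0r 1) f p,
      forall W n m (e : n + 1 = m) (e' : 1 + n = m)
             (x : dghom W X m) (y : dghom W Y n),
        cone_closed f e x y ->
        exists2 g : dghom W Z n, dgclosed g &
          cone_exact f (dgcomp e' p g - x) (dgcomp (add0r n) s g - y)
    & forall W n m (e' : 1 + n = m) (g : dghom W Z n),
        dgclosed g ->
        cone_exact f (dgcomp e' p g) (dgcomp (add0r n) s g) -> dgexact g].

(** j : Y -> Z is the class of the canonical inclusion of [Y] in the cone. *)
Definition is_dgcone_incl X Y Z (f : dghom X Y 0)
    (p : dghom Z X 1) (s : dghom Z Y 0) (j : dghom Y Z 0) : Prop :=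
  dgclosed j /\
  cone_exact f (dgcomp (addr0 1) p j) (dgcomp (add0r 0) s j - dgid Y).

End DgCat.

(** The image of the Yoneda embedding of H^0(A) in D(A) is closed under shifts
    and cones. *)
Definition pretriangulated (K : fieldType) (A : dgCat K) : Prop :=
  (forall (X : A) (k : int), exists (X' : A) (u : dghom X X' (- k))
      (v : dghom X' X k), shift_equiv u v) /\
  (forall (X Y : A) (f : dghom X Y 0), dgclosed f ->
      exists (Z : A) (p : dghom Z X 1) (s : dghom Z Y 0), is_dgcone f p s).

(** A K-linear exact equivalence F : H^0(A) -> T.  A morphism of H^0(A) is the
    class of a closed element of degree 0, so [enh_map] is only constrained on
    closed elements.  The fields [enh_sh], [enh_u], [enh_v] choose the shift
    functor of H^0(A), and [enh_theta] is the isomorphism between F o [1] and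
    [1] o F. *)
Record enhancement (K : fieldType) (A : dgCat K) (T : triCat K) := Enhancement {
  enh_obj : A -> T;
  enh_map : forall X Y : A, dghom X Y 0 -> mor (enh_obj X) (enh_obj Y);
  enh_id : forall X : A, enh_map (dgid X) = idm (enh_obj X);
  enh_comp : forall (X Y Z : A) (g : dghom Y Z 0) (f : dghom X Y 0),
    dgclosed g -> dgclosed f ->
    enh_map (dgcomp (add0r 0) g f) = enh_map g \oc enh_map f;
  enh_lin : forall (X Y : A) (a : K) (f g : dghom X Y 0),
    dgclosed f -> dgclosed g ->
    enh_map (a *: f + g) = a *: enh_map f + enh_map g;
  enh_full : forall (X Y : A) (h : mor (enh_obj X) (enh_obj Y)),
    exists2 f : dghom X Y 0, dgclosed f & enh_map f = h;
  enh_faithful : forall (X Y : A) (f : dghom X Y 0),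
    dgclosed f -> (enh_map f = 0 <-> dgexact f);
  enh_surj : forall Y : T, exists X : A, isom (enh_obj X) Y;
  enh_sh : A -> A;
  enh_u : forall X : A, dghom X (enh_sh X) (- 1);
  enh_v : forall X : A, dghom (enh_sh X) X 1;
  enh_sh_equiv : forall X : A, shift_equiv (enh_u X) (enh_v X);
  enh_theta : forall X : A, mor (enh_obj (enh_sh X)) (sh (enh_obj X));
  enh_theta_iso : forall X : A, is_iso (enh_theta X);
  enh_theta_nat : forall (X Y : A) (f : dghom X Y 0), dgclosed f ->
    shm (enh_map f) \oc enh_theta X =
    enh_theta Y \oc
      enh_map (dgcomp (addNr 1) (enh_u Y) (dgcomp (add0r 1) f (enh_v X)));
  enh_dist : forall (X Y Z : A) (f : dghom X Y 0)
      (p : dghom Z X 1) (s : dghom Z Y 0) (j : dghom Y Z 0),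
    dgclosed f -> is_dgcone f p s -> is_dgcone_incl f p s j ->
    distinguished (enh_map f) (enh_map j)
      (enh_theta X \oc enh_map (dgcomp (addNr 1) (enh_u X) p))
}.

Definition has_enhancement (K : fieldType) (T : triCat K) : Prop :=
  exists A : dgCat K, pretriangulated A /\ inhabited (enhancement A T).

Section Slicing.
Context {K : fieldType} {R : realType} {T : triCat K}.
Implicit Types (X Y : T) (P : R -> set T) (phi : R).

(** The subcategories P(phi) are strict, as in [triangulated_sub].  In the
    Harder-Narasimhan axiom, the objects [F k] filter [X] and the [A k] are
    the successive cones. *)
Record is_slicing P : Prop := IsSlicing {
  slice_zero : forall phi X, is_zero X -> P phi X;
  slice_iso : forall phi X Y, isom X Y -> P phi X -> P phi Y;
  slice_biproduct : forall phi X Y W,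
    is_biproduct X Y W -> P phi X -> P phi Y -> P phi W;
  slice_shift : forall phi X,
    P (phi + 1) X <-> exists2 Y, P phi Y & isom X (sh Y);
  slice_hom : forall phi psi X Y (f : mor X Y),
    psi < phi -> P phi X -> P psi Y -> f = 0;
  slice_HN : forall X, ~ is_zero X ->
    exists (n : nat) (phi : nat -> R) (F A : nat -> T),
      [/\ is_zero (F 0%N), F n = X,
          forall k, (k.+1 < n)%N -> phi k.+1 < phi k
        & forall k, (k < n)%N -> P (phi k) (A k) /\
            exists (f : mor (F k) (F k.+1)) (g : mor (F k.+1) (A k))
                   (h : mor (A k) (sh (F k))), distinguished f g h]
}.

Definition slice_itv P (a b : R) : set T :=
  smallest extension_closed (\bigcup_(phi in `]a, b[) P phi).

(** The intervals ]t - eta, t + eta[ have length less than 1, so that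
    P(]t - eta, t + eta[) is quasi-abelian. *)
Definition locally_finite P : Prop :=
  exists2 eta : R, 0 < eta < 1 / 2 &
    forall t : R, finite_length (slice_itv P (t - eta) (t + eta)).

End Slicing.

(** Locally finite stability conditions; a homomorphism from K_0(T) to the
    complex numbers is a function on objects that is additive on triangles. *)
Record stability (K : fieldType) (R : realType) (T : triCat K) := Stability {
  charge_of : T -> R[i];
  slicing : R -> set T;
  charge_add : forall (X Y Z : T) (f : mor X Y) (g : mor Y Z) (h : mor Z (sh X)),
    distinguished f g h -> charge_of Y = charge_of X + charge_of Z;
  slice_slicing : is_slicing slicing;
  charge_slice : forall (phi : R) (X : T), slicing phi X -> ~ is_zero X ->
    exists2 m : R, 0 < m &
      charge_of X = (m * cos (pi * phi) +i* (m * sin (pi * phi)))%C;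
  slice_locally_finite : locally_finite slicing
}.

Section Semistable.
Context {K : fieldType} {R : realType} {T : triCat K}.
Variable sigma : stability R T.

Definition semistable : set T :=
  [set X | ~ is_zero X /\ exists phi, slicing sigma phi X].

(** Meaningful for semistable [X], whose phase is unique. *)
Definition phase (X : T) : R := xget 0 [set phi | slicing sigma phi X].

End Semistable.

Section Exceptional.
Context {K : fieldType} {T : triCat K}.

Definition exceptional : set T :=
  [set E | homdim 0 E E 1 /\ forall i : int, i != 0 -> homdim i E E 0].

Definition exceptional_collection n (E : 'I_n -> T) : Prop :=
  (forall a, exceptional (E a)) /\
  (forall (i : int) (a b : 'I_n), (b < a)%N -> homdim i (E a) (E b) 0).

Definition full_collection n (E : 'I_n -> T) : Prop := generated (range E) = setT.

Definition strong_collection n (E : 'I_n -> T) : Prop :=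
  forall (a b : 'I_n) (k : int), k != 0 -> homdim k (E a) (E b) 0.

(** Derived points of the full subcategory [A]; those of T are obtained for
    [A = setT]. *)
Definition derived_points (A : set T) : set (set T) :=
  [set generated [set E] | E in A `&` exceptional].

(** Non-commutative curves of genus [l], for l >= -1. *)
Definition nc_curves (l : int) : set (set T) :=
  [set A | exists (E : 'I_2 -> T) (d : nat),
    [/\ exceptional_collection E, strong_collection E,
        homdim 0 (E ord0) (E ord_max) d, d%:Z = l + 1 & A = generated (range E)]].

Context {R : realType}.
Variable sigma : stability R T.

Definition derived_points_ss : set (set T) :=
  [set generated [set E] | E in exceptional `&` semistable sigma].

Definition stable_curves (l : int) : set (set T) :=
  [set A | nc_curves l A /\ A `&` exceptional `<=` semistable sigma].

Definition semistable_curves (l : int) : set (set T) :=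
  [set A | nc_curves l A /\
           infinite_set (derived_points A `&` derived_points_ss)].

Definition sigma_exceptional n (E : 'I_n -> T) : Prop :=
  [/\ exceptional_collection E,
      forall a, semistable sigma (E a),
      forall (a b : 'I_n) (k : int), a != b -> k <= 0 -> homdim k (E a) (E b) 0
    & exists t : R, forall a, t < phase sigma (E a) <= t + 1].

End Exceptional.

(* Main.v *)
From HB Require Import structures.
Require Import Defs.
From mathcomp Require Import all_boot all_order all_algebra.
From mathcomp Require Import all_classical all_reals all_analysis.
From mathcomp Require Import complex zify ring lra.

(** Why the proposition holds.

    Every object of T is an iterated extension of shifts E_a[k], because the
    objects with this property form a triangulated subcategory
    ([generated_filt]).  Such a filtration is a word in the letters (a, k), the
    subobject first.  Two adjacent letters E_a[k], E_b[m] with k < m can be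
    exchanged, or they cancel ([shifted_swap]), because
    Hom(E_b[m], E_a[k+1]) vanishes unless a = b and m = k+1.  Hence words can be
    sorted by decreasing degree ([filt_sort]).

    (i) Let the phases increase along the collection.  Letters of equal degree
    can also be sorted by decreasing phase, since Hom^1(E_b, E_a) = 0 for a < b.
    All E_a have phases in an interval ]t, t+1], so the sorted word is a
    Harder-Narasimhan filtration with repeated phases, and a semistable object
    is an iterated self-extension of one E_a[k].  If it is exceptional, it is
    E_a[k] itself ([increasing_exceptional]).  So there are finitely many
    semistable derived points and no semistable curve.  A stable curve
    <F_0, F_1> would contain three exceptional objects which are shifts of
    members E_a, E_b, E_c of the collection: F_0, F_1 and the left mutation of
    F_1 through F_0 ([left_mutation]).  The nonzero Homs between them give
    a < b <= c <= a ([increasing_stable_curves]).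

    (ii) The pair (E_i, E_j[1]), j = i+1, is strong with l+1 morphisms.  It
    remains to see that an exceptional X in <E_i, E_j> is semistable.  Sorting by
    degree splits X into blocks, because Hom^2 and higher vanish between E_i and
    E_j; so after a shift X is an iterated extension of E_i and E_j
    ([pair_exceptional_filt]).  If X is not semistable, let Y -> X -> Z start its
    Harder-Narasimhan filtration.  The factors have phases in ]t, t+1], hence
    their words have degree 0 ([heart_filt]), and only the letters i and j occur
    in them ([letter_le_max], [letter_ge_min]).  Since Hom(Y, Z) = 0 and
    Hom^1(X, X) = 0, also Hom^1(Y, Z), Hom^1(Y, Y) and Hom^1(Z, Z) vanish
    ([rigid_factors]).  The Euler form therefore satisfies
      1 = chi(X, X) = chi(Y, Y) + chi(Z, Z) + chi(Z, Y),
    with chi(Y, Y) and chi(Z, Z) at least 1.  If Y has a letters i and b letters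
    j, and Z has c and d, then chi(Z, Y) = chi(Z, Y) - chi(Y, Z) is
    (l+1)(ad - bc) ([chi_pair]), and ad - bc > 0 because the central charges see
    that Y has larger phase than Z although the phase of E_i is at least that of
    E_j ([area_pair]).  This is a contradiction
    ([pair_exceptional_semistable]). *)

Set Implicit Arguments.
Unset Strict Implicit.
Unset Printing Implicit Defensive.

Import Order.TTheory GRing.Theory Num.Theory.

Local Open Scope classical_set_scope.
Local Open Scope ring_scope.

Local Notation mcompA := Defs.compA.

(** * Dimensions and exact sequences *)

Section Dimension.
Context {K : fieldType}.
Implicit Types V W : lmodType K.

Definition has_dim V d : Prop := inhabited (Vector.axiom d V).

Definition lin_equiv V W : Prop := exists f : V -> W, linear f /\ bijective f.

Lemma lin_equiv_refl V : lin_equiv V V.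
Proof. by exists id; split => //; exists id. Qed.

Lemma lin_equiv_sym V W : lin_equiv V W -> lin_equiv W V.
Proof.
move=> [f [flin [g fK gK]]]; exists g; split; last by exists f.
by move=> a u v; apply: (can_inj fK); rewrite gK flin !gK.
Qed.

Lemma lin_equiv_trans U V W : lin_equiv U V -> lin_equiv V W -> lin_equiv U W.
Proof.
move=> [f [flin fbij]] [g [glin gbij]]; exists (g \o f); split.
  by move=> a u v /=; rewrite flin glin.
exact: bij_comp.
Qed.

Lemma has_dim_equiv V W d : lin_equiv V W -> has_dim V d -> has_dim W d.
Proof.
move=> /lin_equiv_sym[f [flin fbij]] [[v vlin vbij]]; constructor.
exists (v \o f); last exact: bij_comp.
by move=> a x y /=; rewrite flin vlin.
Qed.

Lemma linear_zero V W (f : V -> W) : linear f -> f 0 = 0.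
Proof. by move=> flin; have := flin (-1) 0 0; rewrite !scaleN1r !addNr. Qed.

Lemma has_dim0P V : has_dim V 0 <-> forall x : V, x = 0.
Proof.
split=> [[[v vlin vbij]] x|V0].
  apply: (bij_inj vbij); rewrite (linear_zero vlin).
  by apply/rowP => -[].
constructor; exists (fun=> 0); first by move=> a x y; apply/rowP => -[].
exists (fun=> 0) => x; first by rewrite (V0 x).
by apply/rowP => -[].
Qed.

Lemma has_dimS_neq0 V d : has_dim V d.+1 -> exists x : V, x <> 0.
Proof.
move=> [[v vlin [u vK uK]]]; exists (u (const_mx 1)) => u0.
have := uK (const_mx 1); rewrite u0 (linear_zero vlin).
by move=> /rowP/(_ ord0); rewrite !mxE => /eqP; rewrite eq_sym oner_eq0.
Qed.

Lemma has_dim1_span V (e x : V) : has_dim V 1 -> e <> 0 -> exists c, x = c *: e.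
Proof.
move=> [[v vlin vbij]] e0.
have ve0 : v e 0 0 != 0.
  apply/eqP => ve; apply: e0; apply: (bij_inj vbij).
  by rewrite (linear_zero vlin); apply/rowP => i; rewrite ord1 ve mxE.
exists (v x 0 0 / v e 0 0); apply: (bij_inj vbij).
have := vlin (v x 0 0 / v e 0 0) e 0.
rewrite addr0 (linear_zero vlin) addr0 => ->.
by apply/rowP => i; rewrite ord1 !mxE divfK.
Qed.

Lemma linear_mx V W d e (f : V -> W) (v : V -> 'rV[K]_d) (w : W -> 'rV[K]_e) :
  linear f -> linear v -> bijective v -> linear w ->
  exists M : 'M[K]_(d, e), forall x, v x *m M = w (f x).
Proof.
move=> flin vlin [u vK uK] wlin.
have ulin : linear u by move=> a x y; apply: (can_inj vK); rewrite vlin !uK.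
have hlin : linear (fun x => w (f (u x))) by move=> a x y; rewrite ulin flin wlin.
pose H := GRing.isLinear.Build K 'rV[K]_d 'rV[K]_e *:%R _ hlin.
pose h : {linear 'rV[K]_d -> 'rV[K]_e} := HB.pack (fun x => w (f (u x))) H.
by exists (lin1_mx h) => x; rewrite mul_rV_lin1 /= vK.
Qed.

Definition exact_at V1 V2 V3 (f : V1 -> V2) (g : V2 -> V3) : Prop :=
  forall y, g y = 0 <-> exists x, f x = y.

Lemma exact_rank V1 V2 V3 d1 d2 d3 (f : V1 -> V2) (g : V2 -> V3)
    (v1 : V1 -> 'rV[K]_d1) (v2 : V2 -> 'rV[K]_d2) (v3 : V3 -> 'rV[K]_d3)
    (F : 'M[K]_(d1, d2)) (G : 'M[K]_(d2, d3)) :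
  bijective v1 -> bijective v2 -> linear v3 -> bijective v3 ->
  (forall x, v1 x *m F = v2 (f x)) -> (forall x, v2 x *m G = v3 (g x)) ->
  exact_at f g -> (\rank F + \rank G = d2)%N.
Proof.
move=> [u1 v1K u1K] [u2 v2K u2K] v3lin v3bij FE GE fg.
suff -> : \rank F = \rank (kermx G) by rewrite mxrank_ker subnK // rank_leq_row.
apply/eqmx_rank; apply/andP; split.
  apply/row_subP => i; apply/sub_kermxP.
  rewrite rowE -[delta_mx _ _]u1K FE GE.
  have -> : g (f (u1 (delta_mx 0 i))) = 0 by apply/fg; exists (u1 (delta_mx 0 i)).
  exact: linear_zero.
apply/row_subP => i.
have : row i (kermx G) *m G = 0 by apply/sub_kermxP/row_sub.
rewrite -[row i _]u2K; set y := u2 _; rewrite GE -(linear_zero v3lin).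
move=> /(bij_inj v3bij)/fg[x <-]; rewrite -FE; exact: submxMl.
Qed.

(** Rank-nullity at each of the six terms. *)
Lemma exact6_dim V0 V1 V2 V3 V4 V5 d0 d1 d2 d3 d4 d5
    (f0 : V0 -> V1) (f1 : V1 -> V2) (f2 : V2 -> V3) (f3 : V3 -> V4) (f4 : V4 -> V5) :
  has_dim V0 d0 -> has_dim V1 d1 -> has_dim V2 d2 ->
  has_dim V3 d3 -> has_dim V4 d4 -> has_dim V5 d5 ->
  linear f0 -> linear f1 -> linear f2 -> linear f3 -> linear f4 ->
  (forall x, f0 x = 0 -> x = 0) ->
  exact_at f0 f1 -> exact_at f1 f2 -> exact_at f2 f3 -> exact_at f3 f4 ->
  (forall y, exists x, f4 x = y) ->
  (d0 + d2 + d4 = d1 + d3 + d5)%N.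
Proof.
move=> [[v0 l0 b0]] [[v1 l1 b1]] [[v2 l2 b2]] [[v3 l3 b3]] [[v4 l4 b4]] [[v5 l5 b5]].
move=> fl0 fl1 fl2 fl3 fl4 inj e0 e1 e2 e3 surj.
have [M0 E0] := linear_mx fl0 l0 b0 l1; have [M1 E1] := linear_mx fl1 l1 b1 l2.
have [M2 E2] := linear_mx fl2 l2 b2 l3; have [M3 E3] := linear_mx fl3 l3 b3 l4.
have [M4 E4] := linear_mx fl4 l4 b4 l5.
have r1 := exact_rank b0 b1 l2 b2 E0 E1 e0.
have r2 := exact_rank b1 b2 l3 b3 E1 E2 e1.
have r3 := exact_rank b2 b3 l4 b4 E2 E3 e2.
have r4 := exact_rank b3 b4 l5 b5 E3 E4 e3.
(* injectivity and surjectivity are exactness at the ends, next to a zero space *)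
have z0 : linear (fun _ : 'rV[K]_0 => 0 : V0) by move=> a x y /=; rewrite scaler0 addr0.
have z5 : linear (fun _ : V5 => 0 : 'rV[K]_0) by move=> a x y; apply/rowP => -[].
have li : linear (@id 'rV[K]_0) by [].
have bi : bijective (@id 'rV[K]_0) by exists id.
have [N0 N0E] := linear_mx z0 li bi l0; have [N5 N5E] := linear_mx z5 l5 b5 li.
have ex0 : exact_at (fun _ : 'rV[K]_0 => 0 : V0) f0.
  move=> y; split=> [/inj ->|[x <-]]; first by exists 0.
  exact: linear_zero.
have ex5 : exact_at f4 (fun _ : V5 => 0 : 'rV[K]_0) by move=> y; split.
have r0 := exact_rank bi b0 l1 b1 N0E E0 ex0.
have r5 := exact_rank b4 b5 li bi E4 N5E ex5.
move: r0 r5 (rank_leq_row N0) (rank_leq_col N5) r1 r2 r3 r4; lia.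
Qed.

Lemma has_dim_inj V d e : has_dim V d -> has_dim V e -> d = e.
Proof.
move=> Vd Ve.
have Z : has_dim ('rV[K]_0 : lmodType K) 0 by apply/has_dim0P => x; apply/rowP => -[].
have l1 : linear (fun _ : 'rV[K]_0 => 0 : V) by move=> a x y /=; rewrite scaler0 addr0.
have l2 : linear (fun _ : V => 0 : 'rV[K]_0) by move=> a x y; apply/rowP => -[].
have l3 : linear (@id V) by [].
have l4 : linear (@id 'rV[K]_0) by [].
have rv0 (x : 'rV[K]_0) : x = 0 by apply/rowP => -[].
have := exact6_dim (f0 := (fun=> 0)) (f1 := id) (f2 := (fun=> 0)) (f3 := id) (f4 := id)
  Z Vd Ve Z Z Z l1 l3 l2 l4 l4 (fun x _ => rv0 x).
rewrite !addn0 !add0n => <- //.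
- move=> y; split=> [->|[x <-]] //; by exists 0.
- move=> y; split=> // _; by exists y.
- by move=> y; split=> [_|_]; [exists 0; rewrite (rv0 y)|apply: rv0].
- by move=> y; split=> [_|_]; [exists y|apply: rv0].
- by move=> y; exists y.
Qed.

Definition vdim V : nat := xget 0%N [set d | has_dim V d].

Lemma vdimP V d : has_dim V d -> has_dim V (vdim V).
Proof. by move=> Vd; apply: (@xgetPex _ 0%N [set d | has_dim V d]); exists d. Qed.

Lemma vdimE V d : has_dim V d -> vdim V = d.
Proof. by move=> Vd; exact: has_dim_inj (vdimP Vd) Vd. Qed.

End Dimension.

(** * Linear categories, shifts and triangles *)

Section LinearCategory.
Context {K : fieldType} {C : linCat K}.
Implicit Types X Y Z W U : C.

Lemma mcomp0l X Y Z (f : mor X Y) : (0 : mor Y Z) \oc f = 0.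
Proof. exact: (linear_zero (@comp_linl _ _ _ _ Z f)). Qed.

Lemma mcomp0r X Y Z (g : mor Y Z) : g \oc (0 : mor X Y) = 0.
Proof. exact: (linear_zero (@comp_linr _ _ X _ _ g)). Qed.

Lemma mcompDl X Y Z (g h : mor Y Z) (f : mor X Y) :
  (g + h) \oc f = g \oc f + h \oc f.
Proof. by have := comp_linl f 1 g h; rewrite !scale1r. Qed.

Lemma mcompDr X Y Z (g : mor Y Z) (f h : mor X Y) :
  g \oc (f + h) = g \oc f + g \oc h.
Proof. by have := comp_linr g 1 f h; rewrite !scale1r. Qed.

Lemma mcompZl X Y Z a (g : mor Y Z) (f : mor X Y) : (a *: g) \oc f = a *: (g \oc f).
Proof. by have := comp_linl f a g 0; rewrite !addr0 mcomp0l addr0. Qed.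

Lemma mcompZr X Y Z a (g : mor Y Z) (f : mor X Y) : g \oc (a *: f) = a *: (g \oc f).
Proof. by have := comp_linr g a f 0; rewrite !addr0 mcomp0r addr0. Qed.

Lemma mcompNl X Y Z (g : mor Y Z) (f : mor X Y) : (- g) \oc f = - (g \oc f).
Proof. by rewrite -!scaleN1r mcompZl. Qed.

Lemma mcompNr X Y Z (g : mor Y Z) (f : mor X Y) : g \oc (- f) = - (g \oc f).
Proof. by rewrite -!scaleN1r mcompZr. Qed.

Definition no_mor X Y : Prop := forall f : mor X Y, f = 0.

Lemma is_iso_id X : is_iso (idm X).
Proof. by exists (idm X); rewrite comp1m. Qed.

Lemma isom_refl X : isom X X.
Proof. by exists (idm X); exact: is_iso_id. Qed.

Lemma isom_sym X Y : isom X Y -> isom Y X.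
Proof. by move=> [f [g [gf fg]]]; exists g, f. Qed.

Lemma isom_trans Y X Z : isom X Y -> isom Y Z -> isom X Z.
Proof.
move=> [f [g [gf fg]]] [h [k [kh hk]]]; exists (h \oc f), (g \oc k); split.
  by rewrite mcompA -[(g \oc k) \oc h]mcompA kh compm1.
by rewrite mcompA -[(h \oc f) \oc g]mcompA fg compm1.
Qed.

Lemma lin_equiv_mor X X' Y Y' :
  isom X X' -> isom Y Y' -> lin_equiv (mor X Y) (mor X' Y').
Proof.
move=> [f [f' [f'f ff']]] [g [g' [g'g gg']]].
exists (fun h => g \oc h \oc f'); split.
  by move=> a u v /=; rewrite mcompDl mcompZl mcompDr mcompZr.
exists (fun h => g' \oc h \oc f) => h.
  by rewrite !mcompA g'g comp1m -mcompA f'f compm1.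
by rewrite !mcompA gg' comp1m -mcompA ff' compm1.
Qed.

Lemma no_mor_dim X Y : no_mor X Y <-> has_dim (mor X Y) 0.
Proof. by rewrite has_dim0P. Qed.

Lemma no_mor_equiv X Y (X' Y' : C) :
  lin_equiv (mor X Y) (mor X' Y') -> no_mor X Y -> no_mor X' Y'.
Proof. by move=> e; rewrite !no_mor_dim; exact: has_dim_equiv. Qed.

Lemma no_mor_isom X Y X' Y' : isom X X' -> isom Y Y' -> no_mor X Y -> no_mor X' Y'.
Proof. by move=> eX eY; apply: no_mor_equiv; exact: lin_equiv_mor. Qed.

Lemma zero_no_morl X Y : is_zero X -> no_mor X Y.
Proof. by move=> X0 f; rewrite -(compm1 f) X0 mcomp0r. Qed.

Lemma zero_no_morr X Y : is_zero Y -> no_mor X Y.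
Proof. by move=> Y0 f; rewrite -(comp1m f) Y0 mcomp0l. Qed.

Lemma is_zero_isom X Y : isom X Y -> is_zero X -> is_zero Y.
Proof.
move=> [f [g [gf fg]]] X0; rewrite /is_zero -fg.
by rewrite (zero_no_morl X0 f) mcomp0l.
Qed.

Lemma biproduct_sym X Y W : is_biproduct X Y W -> is_biproduct Y X W.
Proof.
move=> [i1 [i2 [p1 [p2 [a b c d e]]]]]; exists i2, i1, p2, p1; split => //.
by rewrite addrC.
Qed.

(** The projector onto X is an idempotent of a one-dimensional algebra, hence it
    is 0 or 1. *)
Lemma biproduct_indecomposable X Y W :
  has_dim (mor W W) 1 -> ~ is_zero W -> is_biproduct X Y W -> is_zero X \/ is_zero Y.
Proof.
move=> W1 W0 [i1 [i2 [p1 [p2 [a b c d _]]]]].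
have [k ik] := has_dim1_span (i1 \oc p1) W1 W0.
have [k0|k0] := eqVneq k 0.
  left; rewrite /is_zero.
  have <- : p1 \oc (i1 \oc p1) \oc i1 = idm X by rewrite -mcompA a compm1 a.
  by rewrite ik k0 scale0r mcomp0l mcomp0r.
right; rewrite /is_zero -b.
have : p2 \oc i1 \oc p1 = 0 by rewrite mcompA d mcomp0l.
rewrite ik mcompZr compm1 => /eqP; rewrite scaler_eq0 (negPf k0) /= => /eqP ->.
by rewrite mcomp0l.
Qed.

Lemma nonzero_iso X Y (f : mor X Y) :
  isom X Y -> has_dim (mor X X) 1 -> ~ is_zero X -> f <> 0 -> is_iso f.
Proof.
move=> [g [h [hg gh]]] X1 X0 f0.
have [k hf] := has_dim1_span (h \oc f) X1 X0.
have fE : f = k *: g by rewrite -[f]comp1m -gh -mcompA hf mcompZr compm1.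
have k0 : k != 0 by apply: contra_notN f0 => /eqP k0; rewrite fE k0 scale0r.
by exists (k^-1 *: h); rewrite fE !mcompZl !mcompZr hg gh !scalerA mulVf // mulfV // !scale1r.
Qed.

End LinearCategory.

Section Shift.
Context {K : fieldType} {T : triCat K}.
Implicit Types X Y Z W U : T.

Lemma iso_cancel_l X Y Z (u : mor Y Z) (f g : mor X Y) :
  is_iso u -> u \oc f = u \oc g -> f = g.
Proof.
by move=> [v [vu _]] e; rewrite -(comp1m f) -(comp1m g) -vu -!mcompA e.
Qed.

Lemma iso_cancel_r X Y Z (u : mor X Y) (f g : mor Y Z) :
  is_iso u -> f \oc u = g \oc u -> f = g.
Proof.
by move=> [v [_ uv]] e; rewrite -(compm1 f) -(compm1 g) -uv !mcompA e.
Qed.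

Lemma shm_inj X Y : injective (@shm K T X Y).
Proof.
move=> f g e; apply: (iso_cancel_l (sh_unit_iso Y)).
by rewrite -!sh_unit_nat e.
Qed.

Lemma shim_inj X Y (f g : mor X Y) : shim f = shim g -> f = g.
Proof.
move=> e; apply: (iso_cancel_r (sh_counit_iso X)).
by rewrite !sh_counit_nat e.
Qed.

(** An equivalence is fully faithful; the preimage of h is h conjugated by the
    unit of the equivalence. *)
Lemma shm_bij X Y : bijective (@shm K T X Y).
Proof.
have [v [vu uv]] := sh_unit_iso Y.
have fullP (h : mor (sh X) (sh Y)) : shm (v \oc shim h \oc sh_unit X) = h.
  apply: shim_inj; apply: (iso_cancel_r (sh_unit_iso X)).
  by rewrite sh_unit_nat mcompA uv comp1m.
exists (fun h => v \oc shim h \oc sh_unit X) => // f.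
by apply: shm_inj; rewrite fullP.
Qed.

Lemma shm0 X Y : shm (0 : mor X Y) = 0.
Proof. exact: (linear_zero (@shm_lin _ _ X Y)). Qed.

Lemma shmN X Y (f : mor X Y) : shm (- f) = - shm f.
Proof.
by have := shm_lin (-1) f 0; rewrite shm0 !addr0 !scaleN1r.
Qed.

Lemma shm_full X Y (h : mor (sh X) (sh Y)) : exists f : mor X Y, shm f = h.
Proof. by have [g _ gK] := shm_bij X Y; exists (g h). Qed.

Lemma lin_equiv_sh X Y : lin_equiv (mor X Y) (mor (sh X) (sh Y)).
Proof. by exists shm; split; [exact: shm_lin|exact: shm_bij]. Qed.

Lemma sh_isom X Y : isom X Y -> isom (sh X) (sh Y).
Proof.
move=> [f [g [gf fg]]]; exists (shm f), (shm g).
by rewrite -!shm_comp gf fg !shm_id.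
Qed.

Lemma shi_isom X Y : isom X Y -> isom (shi X) (shi Y).
Proof.
move=> [f [g [gf fg]]]; exists (shim f), (shim g).
by rewrite -!shim_comp gf fg !shim_id.
Qed.

Lemma sh_shi X : isom (sh (shi X)) X.
Proof. by exists (sh_counit X); exact: sh_counit_iso. Qed.

Lemma shi_sh X : isom (shi (sh X)) X.
Proof. by apply: isom_sym; exists (sh_unit X); exact: sh_unit_iso. Qed.

Lemma sh_zero X : is_zero X -> is_zero (sh X).
Proof. by rewrite /is_zero -shm_id => ->; exact: shm0. Qed.

Lemma shi_zero X : is_zero X -> is_zero (shi X).
Proof.
by rewrite /is_zero -shim_id => ->; exact: (linear_zero (@shim_lin _ _ X X)).
Qed.

Lemma shift_zero X i : is_zero X -> is_zero (shift_obj X i).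
Proof.
move=> X0; case: i => k; elim: k => [|k IH] //; first exact: sh_zero.
  exact: shi_zero.
by rewrite /shift_obj iterS; exact: shi_zero.
Qed.

Lemma shift_isom X Y i : isom X Y -> isom (shift_obj X i) (shift_obj Y i).
Proof.
move=> e; case: i => k; first by elim: k => //= k; exact: sh_isom.
elim: k => [|k]; first exact: shi_isom.
by rewrite /shift_obj [X in isom X]iterS [X in isom _ X]iterS; exact: shi_isom.
Qed.

Lemma sh_shift X i : isom (sh (shift_obj X i)) (shift_obj X (i + 1)).
Proof.
case: i => [k|[|k]].
- have -> : Posz k + 1 = Posz k.+1 by lia.
  exact: isom_refl.
- exact: sh_shi.
have -> : Negz k.+1 + 1 = Negz k by lia.
by rewrite /shift_obj [X in sh X]iterS; exact: sh_shi.
Qed.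

Lemma shi_shift X i : isom (shi (shift_obj X i)) (shift_obj X (i - 1)).
Proof.
apply: isom_sym; apply: isom_trans (isom_sym (shi_sh _)) _.
by apply: shi_isom; apply: isom_trans (sh_shift _ _) _; rewrite subrK; exact: isom_refl.
Qed.

Lemma shift_shift X i j : isom (shift_obj (shift_obj X i) j) (shift_obj X (i + j)).
Proof.
case: j => k; elim: k => [|k IH].
- by rewrite addr0; exact: isom_refl.
- have -> : i + Posz k.+1 = i + Posz k + 1 by lia.
  by apply: isom_trans (sh_shift _ _); exact: sh_isom.
- exact: shi_shift.
have -> : i + Negz k.+1 = i + Negz k - 1 by lia.
apply: isom_trans (shi_shift _ _); rewrite {1}/shift_obj iterS; exact: shi_isom.
Qed.

Lemma lin_equiv_shift X Y i :
  lin_equiv (mor X Y) (mor (shift_obj X i) (shift_obj Y i)).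
Proof.
have lin_shi U V : lin_equiv (mor U V) (mor (shi U) (shi V)).
  apply: lin_equiv_trans (lin_equiv_sym (lin_equiv_sh _ _)).
  by apply: lin_equiv_mor; apply: isom_sym; exact: sh_shi.
case: i => k; elim: k => [|k IH].
- exact: lin_equiv_refl.
- exact: lin_equiv_trans IH (lin_equiv_sh _ _).
- exact: lin_shi.
apply: lin_equiv_trans IH _; rewrite /shift_obj ![iter k.+2 _ _]iterS; exact: lin_shi.
Qed.

Lemma lin_equiv_shift2 X Y i j :
  lin_equiv (mor (shift_obj X i) (shift_obj Y j)) (mor X (shift_obj Y (j - i))).
Proof.
apply: lin_equiv_trans (lin_equiv_shift _ _ (- i)) _; apply: lin_equiv_mor.
  by apply: isom_trans (shift_shift _ _ _) _; rewrite subrr; exact: isom_refl.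
exact: shift_shift.
Qed.

Lemma dist_rot X Y Z (f : mor X Y) (g : mor Y Z) (h : mor Z (sh X)) :
  distinguished f g h -> distinguished g h (- shm f).
Proof. by move/tr2. Qed.

Definition tri X Y Z : Prop :=
  exists (f : mor X Y) (g : mor Y Z) (h : mor Z (sh X)), distinguished f g h.

Lemma tri_isom X Y Z X' Y' Z' :
  isom X X' -> isom Y Y' -> isom Z Z' -> tri X Y Z -> tri X' Y' Z'.
Proof.
move=> [a [a' [a'a aa']]] [b [b' [b'b bb']]] [c [c' [c'c cc']]] [f [g [h fgh]]].
exists (b \oc f \oc a'), (c \oc g \oc b'), (shm a \oc h \oc c').
apply: (tr1_iso (a := a) (b := b) (c := c) _ _ _ _ _ _ fgh).
- by exists a'.
- by exists b'.
- by exists c'.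
- by rewrite -!mcompA a'a compm1.
- by rewrite -!mcompA b'b compm1.
- by rewrite -!mcompA c'c compm1.
Qed.

Lemma tri_rot X Y Z : tri X Y Z -> tri Y Z (sh X).
Proof. by move=> [f [g [h /tr2]]]; exists g, h, (- shm f). Qed.

Lemma tri_unrot X Y Z : tri X Y Z -> tri (shi Z) X Y.
Proof.
move=> [f [g [h fgh]]].
have [c' [c'c cc']] := sh_counit_iso Z.
have [k kE] := shm_full (- (h \oc sh_counit Z)).
exists k, f, (c' \oc g); apply/tr2; rewrite kE opprK.
apply: (tr1_iso (a := idm X) (b := idm Y) (c := c') _ _ _ _ _ _ fgh).
- exact: is_iso_id.
- exact: is_iso_id.
- by exists (sh_counit Z).
- by rewrite comp1m compm1.
- by rewrite compm1.
- by rewrite shm_id comp1m -mcompA cc' compm1.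
Qed.

Lemma tri_sh X Y Z : tri X Y Z -> tri (sh X) (sh Y) (sh Z).
Proof. by move=> /tri_rot/tri_rot/tri_rot. Qed.

Lemma tri_shi X Y Z : tri X Y Z -> tri (shi X) (shi Y) (shi Z).
Proof. by move=> /tri_unrot/tri_unrot/tri_unrot. Qed.

Lemma tri_shift X Y Z i :
  tri X Y Z -> tri (shift_obj X i) (shift_obj Y i) (shift_obj Z i).
Proof.
move=> t; case: i => k; elim: k => [|k IH] //.
- exact: tri_sh.
- exact: tri_shi.
by rewrite /shift_obj ![iter k.+2 _ _]iterS; exact: tri_shi.
Qed.

Lemma tri_comp0 X Y Z (f : mor X Y) (g : mor Y Z) h :
  distinguished f g h -> g \oc f = 0.
Proof.
move=> fgh; have [N N0] := has_zero T.
have sq : f \oc idm X = f \oc idm X by [].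
have [c [cE _] ] := tr3 (tr1_id X N0) fgh sq.
by rewrite -cE mcomp0r.
Qed.

(** Complete u to a morphism from the triangle of the identity of U. *)
Lemma tri_lift X Y Z (f : mor X Y) (g : mor Y Z) h U (u : mor U Y) :
  distinguished f g h -> g \oc u = 0 -> exists v : mor U X, f \oc v = u.
Proof.
move=> /tr2 fgh gu; have [N N0] := has_zero T.
have sq : (0 : mor N Z) \oc (0 : mor U N) = g \oc u by rewrite mcomp0l.
have /tr2 idU := tr1_id U N0.
have [c [_] ] := tr3 idU fgh sq; have [v <-] := shm_full c.
rewrite mcompNl mcompNr => /oppr_inj; rewrite -!shm_comp compm1.
by move=> /shm_inj uE; exists v.
Qed.

Lemma tri_extend X Y Z (f : mor X Y) (g : mor Y Z) h U (u : mor Y U) :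
  distinguished f g h -> u \oc f = 0 -> exists v : mor Z U, v \oc g = u.
Proof.
move=> fgh uf; have [N N0] := has_zero T.
have idU : distinguished (0 : mor N U) (idm U) (0 : mor U (sh N)).
  by apply/tr2; rewrite shm0 oppr0; apply: tr1_id; exact: sh_zero.
have sq : u \oc f = (0 : mor N U) \oc (0 : mor X N) by rewrite uf mcomp0l.
have [v [vE _] ] := tr3 fgh idU sq.
by exists v; rewrite vE comp1m.
Qed.

Lemma no_mor_tri_r U X Y Z : tri X Y Z -> no_mor U X -> no_mor U Z -> no_mor U Y.
Proof.
move=> [f [g [h fgh]]] UX UZ u.
by have [v <-] := tri_lift fgh (UZ (g \oc u)); rewrite (UX v) mcomp0r.
Qed.

Lemma no_mor_tri_l U X Y Z : tri X Y Z -> no_mor X U -> no_mor Z U -> no_mor Y U.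
Proof.
move=> [f [g [h fgh]]] XU ZU u.
by have [v <-] := tri_extend fgh (XU (u \oc f)); rewrite (ZU v) mcomp0l.
Qed.

Lemma no_mor_zero X : no_mor X X -> is_zero X.
Proof. by move=> X0; exact: X0. Qed.

Lemma tri_zero_3 X Y Z : tri X Y Z -> is_zero Z -> isom X Y.
Proof.
move=> [f [g [h fgh]]] Z0.
have [v fv] := tri_lift fgh (zero_no_morr Z0 (g \oc idm Y)).
exists f, v; split => //; apply/eqP; rewrite -subr_eq0; apply/eqP.
apply: shm_inj; rewrite shm0.
have [] := tri_lift (u := shm (v \oc f - idm X)) (dist_rot (dist_rot fgh)).
  by rewrite mcompNl -shm_comp mcompDr mcompNr mcompA fv comp1m compm1 subrr shm0 oppr0.
by move=> w <-; rewrite (zero_no_morl Z0 h) mcomp0l.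
Qed.

Lemma tri_zero_1 X Y Z : tri X Y Z -> is_zero X -> isom Y Z.
Proof. by move=> /tri_rot t X0; apply: tri_zero_3 t _; exact: sh_zero. Qed.

Lemma isom_tri_3 X Y Z : isom X Y -> is_zero Z -> tri X Y Z.
Proof.
move=> e Z0; apply: tri_isom (isom_refl X) e (isom_refl Z) _.
by exists (idm X), 0, 0; exact: tr1_id.
Qed.

Lemma isom_tri_1 X Y Z : is_zero X -> isom Y Z -> tri X Y Z.
Proof.
move=> X0 e; have /tri_unrot := isom_tri_3 e (sh_zero X0).
by apply: tri_isom; [exact: shi_sh|exact: isom_refl|exact: isom_refl].
Qed.

(** The vanishing connecting map gives a section s of g and a retraction r of f;
    r is corrected to vanish on s. *)
Lemma tri_biproduct X Y Z (f : mor X Y) (g : mor Y Z) :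
  distinguished f g 0 -> is_biproduct X Z Y.
Proof.
move=> fg.
have [s gs] := tri_lift (dist_rot fg) (mcomp0l _ (idm Z)).
have [r0 r0f] := tri_extend (dist_rot (dist_rot fg))
                            (mcomp0r _ (idm (sh X))).
have [r' r'E] := shm_full r0.
have rf : (- r') \oc f = idm X.
  by apply: shm_inj; rewrite shm_comp shmN r'E mcompNl -mcompNr r0f shm_id.
move: (- r') rf => r rf {r0 r' r0f r'E}.
have gf := tri_comp0 fg.
pose r1 := r \oc (idm Y - s \oc g).
have r1f : r1 \oc f = idm X.
  by rewrite -mcompA mcompDl mcompNl comp1m -mcompA gf mcomp0r subr0.
have r1s : r1 \oc s = 0.
  by rewrite -mcompA mcompDl mcompNl comp1m -mcompA gs compm1 subrr mcomp0r.
clearbody r1; exists f, s, r1, g; split => //.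
apply/eqP; rewrite -subr_eq0; apply/eqP.
set e := (X in X = 0).
have ge : g \oc e = 0.
  rewrite /e mcompDr mcompNr mcompDr !mcompA gf gs mcomp0l comp1m.
  by rewrite add0r compm1 subrr.
have [w fw] := tri_lift fg ge.
have : r1 \oc e = 0.
  by rewrite /e mcompDr mcompNr mcompDr !mcompA r1f r1s mcomp0l comp1m addr0 compm1 subrr.
by rewrite -fw mcompA r1f comp1m => ->; rewrite mcomp0r.
Qed.

Lemma biproduct_tri X Y W : is_biproduct X Y W -> tri X W Y.
Proof.
move=> [i1 [i2 [p1 [p2 [p1i1 p2i2 p1i2 p2i1 pE]]]]].
have [C [c [d icd]]] := tr1_cone i1.
have d0 : d = 0.
  have := tri_comp0 (dist_rot (dist_rot icd)).
  rewrite mcompNl => /eqP; rewrite oppr_eq0 => /eqP i1d.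
  by rewrite -[d]comp1m -shm_id -p1i1 shm_comp -mcompA i1d mcomp0r.
have [v vc] := tri_extend icd p2i1.
suff e : isom C Y by apply: tri_isom (isom_refl _) (isom_refl _) e _; exists i1, c, d.
exists v, (c \oc i2); split; last by rewrite mcompA vc.
have ci1 := tri_comp0 icd.
have : (c \oc i2 \oc v - idm C) \oc c = 0.
  rewrite mcompDl mcompNl comp1m -!mcompA vc.
  have -> : i2 \oc p2 = idm W - i1 \oc p1 by rewrite -pE addrC addKr.
  by rewrite mcompDr mcompNr mcompA ci1 mcomp0l subr0 compm1 subrr.
move=> /(tri_extend (dist_rot icd))[w].
rewrite d0 mcomp0r => /esym/eqP; rewrite subr_eq0 => /eqP <-; by rewrite mcompA.
Qed.

Lemma tri_split X Y Z : tri X Y Z -> no_mor Z (sh X) -> is_biproduct X Z Y.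
Proof.
by move=> [f [g [h fgh]]] /(_ h) h0; rewrite h0 in fgh; exact: tri_biproduct fgh.
Qed.

Lemma tri_swap X Y Z : tri X Y Z -> no_mor Z (sh X) -> tri Z Y X.
Proof. by move=> t h; apply: biproduct_tri; apply: biproduct_sym; exact: tri_split. Qed.

(** The octahedral axiom as a third isomorphism theorem: Y/X = (Y/A)/(X/A). *)
Lemma octahedron_sub A X X' Y Z :
  tri A X X' -> tri X Y Z -> exists2 Y', tri A Y Y' & tri X' Y' Z.
Proof.
move=> [f [f1 [f2 df]]] [g [g1 [g2 dg]]].
have [Y' [h1 [h2 dh]]] := tr1_cone (g \oc f).
have [u [v [duv _ _ _ _]]] := tr4 df dg dh.
by exists Y'; [exists (g \oc f), h1, h2|exists u, v, (shm f1 \oc g2)].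
Qed.

(** The octahedral axiom lifts a subobject of Y/A to Y. *)
Lemma octahedron_quot A Y Y' X' Z :
  tri A Y Y' -> tri X' Y' Z -> exists2 X, tri X Y Z & tri A X X'.
Proof.
move=> /tri_rot t1 /tri_rot t2.
have [f [f1 [f2 df]]] := t1; have [g [g1 [g2 dg]]] := t2.
have [C [h1 [h2 dh]]] := tr1_cone (g \oc f).
have [u [v [duv _ _ _ _]]] := tr4 df dg dh.
exists (shi C).
  by apply: tri_unrot; exists (g \oc f), h1, h2.
have : tri (sh A) C (sh X') by exists u, v, (shm f1 \oc g2).
by move=> /tri_shi; apply: tri_isom; [exact: shi_sh|exact: isom_refl|exact: shi_sh].
Qed.

End Shift.

(** * Filtrations by a word of objects *)

Section Filtration.
Context {K : fieldType} {T : triCat K}.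
Implicit Types X Y Z U V : T.

(** The factors are listed from the innermost subobject outwards, so a
    Harder-Narasimhan filtration has decreasing phases along its word. *)
Fixpoint filt (I : Type) (L : I -> T) (w : seq I) X : Prop :=
  if w is x :: w' then exists2 Y, tri (L x) X Y & filt L w' Y else is_zero X.

Lemma no_mor_shi X Y : no_mor X (shi Y) <-> no_mor (sh X) Y.
Proof.
have e : lin_equiv (mor X (shi Y)) (mor (sh X) Y).
  apply: lin_equiv_trans (lin_equiv_sh _ _) _.
  by apply: lin_equiv_mor; [exact: isom_refl|exact: sh_shi].
by split; apply: no_mor_equiv => //; exact: lin_equiv_sym.
Qed.

Lemma no_mor_sh X Y : no_mor (shi X) Y <-> no_mor X (sh Y).
Proof.
have e : lin_equiv (mor (shi X) Y) (mor X (sh Y)).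
  apply: lin_equiv_trans (lin_equiv_sh _ _) _.
  by apply: lin_equiv_mor; [exact: sh_shi|exact: isom_refl].
by split; apply: no_mor_equiv => //; exact: lin_equiv_sym.
Qed.

Section Words.
Context {I : eqType} (L : I -> T).
Implicit Types (x y : I) (w : seq I).

Lemma filt_isom w X X' : isom X X' -> filt L w X -> filt L w X'.
Proof.
case: w => [|x w] e /=; first exact: is_zero_isom.
move=> [Y t wY]; exists Y => //.
exact: tri_isom (isom_refl _) e (isom_refl _) t.
Qed.

Lemma filt1 x X : isom (L x) X -> filt L [:: x] X.
Proof.
by move=> e; have [N N0] := has_zero T; exists N => //; exact: isom_tri_3.
Qed.

Lemma filt1_isom x X : filt L [:: x] X -> isom (L x) X.
Proof. by move=> [Y]; exact: tri_zero_3. Qed.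

Lemma filt_cat w1 w2 X Y Z :
  tri X Y Z -> filt L w1 X -> filt L w2 Z -> filt L (w1 ++ w2) Y.
Proof.
elim: w1 X Y => [|x w1 IH] X Y t /=.
  by move=> X0; apply: filt_isom; apply: isom_sym; exact: tri_zero_1 t X0.
move=> [X' t' wX'] wZ; have [Y' tY' tX'] := octahedron_sub t' t.
by exists Y' => //; exact: IH tX' wX' wZ.
Qed.

Lemma filt_split w1 w2 Y :
  filt L (w1 ++ w2) Y -> exists X Z, [/\ tri X Y Z, filt L w1 X & filt L w2 Z].
Proof.
elim: w1 Y => [|x w1 IH] Y /=.
  move=> wY; have [N N0] := has_zero T; exists N, Y; split => //.
  exact: isom_tri_1 N0 (isom_refl Y).
move=> [Y' t /IH[X' [Z [tX' wX' wZ]]]].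
have [X tX tX1] := octahedron_quot t tX'.
by exists X, Z; split => //; exists X'.
Qed.

Lemma filt_filter (p : pred I) w X :
  (forall x, x \in w -> ~~ p x -> is_zero (L x)) ->
  filt L w X -> filt L [seq x <- w | p x] X.
Proof.
elim: w X => //= x w IH X w0 [Y t wY].
have {}IH : filt L [seq x <- w | p x] Y.
  by apply: IH wY => y yw; apply: w0; rewrite inE yw orbT.
case: ifP => [_|/negbT px]; first by exists Y.
apply: filt_isom IH; apply: isom_sym; apply: tri_zero_1 t _.
by apply: w0 px; rewrite mem_head.
Qed.

Lemma filt_no_mor_l w X U :
  (forall x, x \in w -> no_mor (L x) U) -> filt L w X -> no_mor X U.
Proof.
elim: w X => [|x w IH] X wU /=; first exact: zero_no_morl.
move=> [Y t wY]; apply: no_mor_tri_l t _ _; first by apply: wU; rewrite mem_head.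
by apply: IH wY => y yw; apply: wU; rewrite inE yw orbT.
Qed.

Lemma filt_no_mor_r w X U :
  (forall x, x \in w -> no_mor U (L x)) -> filt L w X -> no_mor U X.
Proof.
elim: w X => [|x w IH] X wU /=; first exact: zero_no_morr.
move=> [Y t wY]; apply: no_mor_tri_r t _ _; first by apply: wU; rewrite mem_head.
by apply: IH wY => y yw; apply: wU; rewrite inE yw orbT.
Qed.

(** Insertion sort.  A misplaced adjacent pair of letters spans a subquotient M,
    and either M is zero and both letters are deleted, or they are exchanged. *)
Lemma filt_sort (le : rel I) w X :
  total le -> transitive le ->
  (forall x y M, ~~ le x y -> tri (L x) M (L y) -> is_zero M \/ tri (L y) M (L x)) ->
  filt L w X -> exists w', [/\ sorted le w', {subset w' <= w} & filt L w' X].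
Proof.
move=> le_total le_trans swap.
have insert x v Y : sorted le v -> filt L (x :: v) Y ->
    exists w', [/\ sorted le w', {subset w' <= x :: v} & filt L w' Y].
  elim: v x Y => [|y v IH] x Y v_sorted xvY; first by exists [:: x]; split.
  have [xy|yx] := boolP (le x y); first by exists [:: x, y & v]; split; rewrite //= xy.
  have [M [Z [tM xM vZ]]] := filt_split (w1 := [:: x; y]) xvY.
  case: xM => M' tx /filt1_isom My.
  have {}tx : tri (L x) M (L y).
    exact: tri_isom (isom_refl _) (isom_refl _) (isom_sym My) tx.
  have [M0|ty] := swap _ _ _ yx tx.
    exists v; split; first exact: path_sorted v_sorted.
      by move=> z zv; rewrite !inE zv !orbT.
    by apply: filt_isom vZ; apply: isom_sym; exact: tri_zero_1 tM M0.
  have [Y' tY' tY] := octahedron_sub ty tM.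
  have xvY' : filt L (x :: v) Y' by exists Z.
  have [w' [w'_sorted w'_sub w'Y]] := IH _ _ (path_sorted v_sorted) xvY'.
  exists (y :: w'); split; last by exists Y'.
    rewrite /= path_sortedE // w'_sorted andbT; apply/allP => z /w'_sub.
    rewrite inE => /orP[/eqP ->|zv].
      by have := le_total x y; rewrite (negPf yx).
    by move: v_sorted; rewrite /= path_sortedE // => /andP[/allP/(_ _ zv) yz _].
  move=> z; rewrite inE => /orP[/eqP ->|/w'_sub]; first by rewrite !inE eqxx orbT.
  by rewrite !inE => /orP[->//|->]; rewrite !orbT.
elim: w X => [|x w IH] X /=; first by exists [::]; split.
move=> [Y t /IH[w' [w'_sorted w'_sub w'Y]]].
have xwX : filt L (x :: w') X by exists Y.
have [v [v_sorted v_sub vX]] := insert _ _ _ w'_sorted xwX.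
exists v; split => // z /v_sub; rewrite !inE => /orP[->//|/w'_sub ->].
by rewrite orbT.
Qed.

(** If the inclusion of the first factor is zero, then its shift is a direct
    summand of the quotient. *)
Lemma filt_head_zero x w X :
  filt L (x :: w) X -> no_mor (L x) X ->
  (forall y, y \in w -> no_mor (sh (L x)) (L y)) -> is_zero (L x).
Proof.
move=> [Y [f [g [h fgh]]] wY] xX wx.
have f0 : (- shm f) \oc idm (sh (L x)) = 0.
  by rewrite (xX f) shm0 oppr0 mcomp0l.
have [v hv] := tri_lift (dist_rot (dist_rot fgh)) f0.
by apply: shm_inj; rewrite shm0 shm_id -hv (filt_no_mor_r wx wY v) mcomp0r.
Qed.

(** Dually, if the projection to the last factor is zero, then that factor is a
    direct summand of the shift of the remaining subobject. *)
Lemma filt_last_zero z w X :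
  filt L (rcons w z) X -> no_mor X (L z) ->
  (forall y, y \in w -> no_mor (L y) (shi (L z))) -> is_zero (L z).
Proof.
rewrite -cats1 => /filt_split[Y [Z [t wY /filt1_isom zZ]]] Xz wz.
have {t} [f [g [h fgh]]] := tri_isom (isom_refl Y) (isom_refl X) (isom_sym zZ) t.
have gE : idm (L z) \oc g = 0 by rewrite comp1m (Xz g).
have [v vh] := tri_extend (dist_rot fgh) gE.
have /no_mor_shi Yz := filt_no_mor_l wz wY.
by rewrite /is_zero -vh (Yz v) mcomp0l.
Qed.

End Words.

Lemma filt_map (I J : eqType) (L : I -> T) (L' : J -> T) (h : I -> J) w X :
  (forall x, x \in w -> isom (L x) (L' (h x))) ->
  filt L w X -> filt L' [seq h x | x <- w] X.
Proof.
elim: w X => //= x w IH X wh [Y t wY]; exists Y.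
  by apply: tri_isom (wh _ _) (isom_refl _) (isom_refl _) t; rewrite mem_head.
by apply: IH wY => y yw; apply: wh; rewrite inE yw orbT.
Qed.

Lemma filt_shift (I : Type) (L : I -> T) w X i :
  filt L w X -> filt (fun x => shift_obj (L x) i) w (shift_obj X i).
Proof.
elim: w X => [|x w IH] X /=.
  exact: shift_zero.
by move=> [Y t wY]; exists (shift_obj Y i); [exact: tri_shift|exact: IH].
Qed.

Lemma filt_no_mor (I J : eqType) (L : I -> T) (L' : J -> T) k v w X Y :
  (forall x y, x \in v -> y \in w -> no_mor (L x) (shift_obj (L' y) k)) ->
  filt L v X -> filt L' w Y -> no_mor X (shift_obj Y k).
Proof.
move=> vw vX /(filt_shift k) wY; apply: filt_no_mor_l vX => x xv.
by apply: filt_no_mor_r wY => y; exact: vw.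
Qed.

Lemma sub_generated (S : set T) : S `<=` generated S.
Proof. by move=> X SX A [_ SA]; exact: SA. Qed.

Lemma generated_sub (S A : set T) :
  triangulated_sub A -> S `<=` A -> generated S `<=` A.
Proof. by move=> At SA X XS; exact: (XS A (conj At SA)). Qed.

Lemma generated_triangulated (S : set T) : triangulated_sub (generated S).
Proof.
split=> [X X0|X Y e SX|X SX|X SX|X Y Z f g h t SX SY] A AP;
  have [[z i s s' c] _] := AP.
- exact: z.
- exact: i e (SX A AP).
- exact: s (SX A AP).
- exact: s' (SX A AP).
- exact: c t (SX A AP) (SY A AP).
Qed.

Lemma generated_shift (S : set T) X i : generated S X -> generated S (shift_obj X i).
Proof.
have [_ _ Ssh Sshi _] := generated_triangulated S.
move=> SX; case: i => k; elim: k => [|k IH].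
- exact: SX.
- exact: Ssh IH.
- exact: Sshi SX.
by rewrite /shift_obj iterS; exact: Sshi IH.
Qed.

Definition shifted (I : Type) (E : I -> T) (x : I * int) : T := shift_obj (E x.1) x.2.

(** The filtered objects are closed under cones, since a cone of X -> Y is an
    extension of X[1] by Y. *)
Lemma generated_filt (I : eqType) (E : I -> T) (D : set I) X :
  generated (E @` D) X ->
  exists2 w, filt (shifted E) w X & forall x, x \in w -> D x.1.
Proof.
pose A := [set X | exists2 w, filt (shifted E) w X & forall x, x \in w -> D x.1].
have shiftA Y i : A Y -> A (shift_obj Y i).
  move=> [w /(filt_shift i) wY wD].
  exists [seq (x.1, x.2 + i) | x <- w]; last by move=> _ /mapP[x xw ->]; exact: (wD x xw).
  apply: filt_map wY => x _; exact: shift_shift.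
apply: (generated_sub (A := A)); last first.
  move=> _ [i Di <-]; exists [:: (i, 0)]; last by move=> x; rewrite inE => /eqP ->.
  exact/filt1/isom_refl.
split=> [Y Y0|Y Z e [w wY wD]|Y|Y|Y Z C f g h fgh AY AZ].
- by exists [::].
- by exists w => //; exact: filt_isom wY.
- exact: (shiftA Y 1).
- exact: (shiftA Y (-1)).
have t : tri Y Z C by exists f, g, h.
have [v vZ vD] := AZ; have [w wY wD] := shiftA Y 1 AY.
exists (v ++ w); first exact: filt_cat (tri_rot t) vZ wY.
by move=> x; rewrite mem_cat => /orP[/vD|/wD].
Qed.

End Filtration.

(** * The Euler form *)

Section Euler.
Context {K : fieldType} {T : triCat K}.
Implicit Types X Y Z U V : T.

Lemma exact_post X Y Z (f : mor X Y) (g : mor Y Z) h U :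
  distinguished f g h ->
  exact_at (fun u : mor U X => f \oc u) (fun u : mor U Y => g \oc u).
Proof.
move=> fgh u; split; first exact: tri_lift fgh.
by move=> [v <-]; rewrite mcompA (tri_comp0 fgh) mcomp0l.
Qed.

Lemma exact_pre X Y Z (f : mor X Y) (g : mor Y Z) h U :
  distinguished f g h ->
  exact_at (fun u : mor Z U => u \oc g) (fun u : mor Y U => u \oc f).
Proof.
move=> fgh u; split; first exact: tri_extend fgh.
by move=> [v <-]; rewrite -mcompA (tri_comp0 fgh) mcomp0r.
Qed.

(** The Euler form when Hom^k(U, V) = 0 for k outside {0, 1}. *)
Definition chi U V : int := (vdim (mor U V))%:Z - (vdim (mor U (sh V)))%:Z.

Lemma no_mor_homdim i X Y : homdim i X Y 0 <-> no_mor X (shift_obj Y i).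
Proof. by rewrite no_mor_dim. Qed.

Lemma vdim_no_mor X Y : no_mor X Y -> vdim (mor X Y) = 0%N.
Proof. by move=> /no_mor_dim; exact: vdimE. Qed.

Lemma vdim_equiv (V W : lmodType K) : lin_equiv V W -> vdim V = vdim W.
Proof.
move=> e; rewrite /vdim; congr xget; rewrite predeqE => d /=.
by split; apply: has_dim_equiv => //; exact: lin_equiv_sym.
Qed.

Lemma chi_zero_l U V : is_zero U -> chi U V = 0.
Proof. by move=> U0; rewrite /chi !vdim_no_mor //; exact: zero_no_morl. Qed.

Lemma chi_zero_r U V : is_zero V -> chi U V = 0.
Proof.
by move=> V0; rewrite /chi !vdim_no_mor //; apply: zero_no_morr => //; exact: sh_zero.
Qed.

Hypothesis T_proper : proper_cat T.

Lemma mor_vdim U V : has_dim (mor U V) (vdim (mor U V)).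
Proof. by have [/(_ 0)[d] Ud _] := T_proper U V; exact: vdimP Ud. Qed.

(** The vanishing conditions cut the long exact sequence of Hom(U, -) down to six
    terms. *)
Lemma chi_tri_r U X Y Z :
  tri X Y Z -> no_mor U (shi Z) -> no_mor U (sh (sh X)) ->
  chi U Y = chi U X + chi U Z.
Proof.
move=> [f [g [h d0]]] UZ UX.
have d1 := dist_rot d0; have d2 := dist_rot d1; have d3 := dist_rot d2.
have d4 := dist_rot d3.
suff: (vdim (mor U X) + vdim (mor U Z) + vdim (mor U (sh Y)) =
       vdim (mor U Y) + vdim (mor U (sh X)) + vdim (mor U (sh Z)))%N.
  by rewrite /chi; lia.
refine (@exact6_dim K _ _ _ _ _ _ _ _ _ _ _ _ _ _ _ _ _
  (mor_vdim _ _) (mor_vdim _ _) (mor_vdim _ _) (mor_vdim _ _)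
  (mor_vdim _ _) (mor_vdim _ _) (comp_linr f) (comp_linr g) (comp_linr h)
  (comp_linr (- shm f)) (comp_linr (- shm g)) _ (exact_post d0)
  (exact_post d1) (exact_post d2) (exact_post d3) _).
  move=> u fu; apply: shm_inj; rewrite shm0.
  have fu' : (- shm f) \oc shm u = 0 by rewrite mcompNl -shm_comp fu shm0 oppr0.
  have [v <-] := tri_lift d2 fu'.
  by have /no_mor_shi/(_ v) -> := UZ; rewrite mcomp0r.
by move=> u; apply: (tri_lift d4); exact: UX.
Qed.

Lemma chi_tri_l V X Y Z :
  tri X Y Z -> no_mor (sh X) V -> no_mor Z (sh (sh V)) ->
  chi Y V = chi X V + chi Z V.
Proof.
move=> [f [g [h d0]]] XV ZV.
have d1 := dist_rot d0; have d2 := dist_rot d1; have d3 := dist_rot d2.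
have d4 := dist_rot d3.
suff: (vdim (mor (sh Z) (sh V)) + vdim (mor (sh X) (sh V)) + vdim (mor Y (sh V)) =
       vdim (mor (sh Y) (sh V)) + vdim (mor Z (sh V)) + vdim (mor X (sh V)))%N.
  by rewrite /chi -!(vdim_equiv (lin_equiv_sh _ V)); lia.
refine (@exact6_dim K _ _ _ _ _ _ _ _ _ _ _ _ _ _ _ _ _
  (mor_vdim _ _) (mor_vdim _ _) (mor_vdim _ _) (mor_vdim _ _)
  (mor_vdim _ _) (mor_vdim _ _) (comp_linl (- shm g)) (comp_linl (- shm f))
  (comp_linl h) (comp_linl g) (comp_linl f) _ (exact_pre d3)
  (exact_pre d2) (exact_pre d1) (exact_pre d0) _).
  move=> u ug; have [v <-] := tri_extend d4 ug.
  have XV' : no_mor (sh (sh X)) (sh V) := no_mor_equiv (lin_equiv_sh _ _) XV.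
  by rewrite (XV' v) mcomp0l.
move=> u; have uh : shm u \oc h = 0 by exact: ZV.
have [v vf] := tri_extend d2 uh; have [v' v'E] := shm_full (- v).
exists v'; apply: shm_inj.
by rewrite shm_comp v'E mcompNl -mcompNr vf.
Qed.

Lemma chi_filt_r (I : eqType) (L : I -> T) w U X :
  (forall x, x \in w -> no_mor U (shi (L x))) ->
  (forall x, x \in w -> no_mor U (sh (sh (L x)))) ->
  filt L w X -> chi U X = \sum_(x <- w) chi U (L x).
Proof.
elim: w X => [|x w IH] X wneg w2 /=; first by move=> X0; rewrite big_nil chi_zero_r.
move=> [Y t wY].
have wneg' y : y \in w -> no_mor U (shi (L y)).
  by move=> yw; apply: wneg; rewrite inE yw orbT.
rewrite big_cons (chi_tri_r t).
- congr (_ + _); apply: IH wneg' _ wY.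
  by move=> y yw; apply: w2; rewrite inE yw orbT.
- exact: (filt_no_mor_r (L := fun x => shi (L x))) wneg' (filt_shift (-1) wY).
- by apply: w2; rewrite mem_head.
Qed.

Lemma chi_filt_l (I : eqType) (L : I -> T) w V X :
  (forall x, x \in w -> no_mor (sh (L x)) V) ->
  (forall x, x \in w -> no_mor (L x) (sh (sh V))) ->
  filt L w X -> chi X V = \sum_(x <- w) chi (L x) V.
Proof.
elim: w X => [|x w IH] X wneg w2 /=; first by move=> X0; rewrite big_nil chi_zero_l.
move=> [Y t wY].
have w2' y : y \in w -> no_mor (L y) (sh (sh V)).
  by move=> yw; apply: w2; rewrite inE yw orbT.
rewrite big_cons (chi_tri_l t).
- congr (_ + _); apply: IH _ w2' wY.
  by move=> y yw; apply: wneg; rewrite inE yw orbT.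
- by apply: wneg; rewrite mem_head.
- exact: filt_no_mor_l w2' wY.
Qed.

End Euler.

(** * Slicings and exceptional objects *)

Section Slicing.
Context {K : fieldType} {R : realType} {T : triCat K}.
Implicit Types X Y Z : T.
Variable sigma : stability R T.

Notation P := (slicing sigma).

Lemma slicing_no_mor phi psi X Y : psi < phi -> P phi X -> P psi Y -> no_mor X Y.
Proof. by move=> lt PX PY f; exact: (slice_hom (slice_slicing sigma)) lt PX PY. Qed.

Lemma slicing_isom phi X Y : isom X Y -> P phi X -> P phi Y.
Proof. exact: (slice_iso (slice_slicing sigma)). Qed.

Lemma phase_slicing X : semistable sigma X -> P (phase sigma X) X.
Proof. by move=> [_ [phi PX]]; apply: (@xgetPex _ 0 [set psi | P psi X]); exists phi. Qed.

Lemma slicing_sh phi X : P phi X -> P (phi + 1) (sh X).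
Proof.
by move=> PX; apply/(slice_shift (slice_slicing sigma)); exists X => //; exact: isom_refl.
Qed.

Lemma slicing_shi phi X : P phi X -> P (phi - 1) (shi X).
Proof.
rewrite -{1}(subrK 1 phi) => /(slice_shift (slice_slicing sigma))[Y PY XY].
apply: slicing_isom PY; apply: isom_trans (isom_sym (shi_sh Y)) _.
exact/shi_isom/isom_sym.
Qed.

Lemma slicing_shift phi X i : P phi X -> P (phi + i%:~R) (shift_obj X i).
Proof.
move=> PX; case: i => k; elim: k => [|k IH].
- by rewrite addr0.
- have -> : phi + (Posz k.+1)%:~R = phi + (Posz k)%:~R + 1.
    by rewrite -addrA; congr (_ + _); rewrite -!pmulrn -natr1.
  exact: slicing_sh.
- exact: slicing_shi.
have -> : phi + (Negz k.+1)%:~R = phi + (Negz k)%:~R - 1.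
  by rewrite -addrA; congr (_ + _); rewrite !NegzE !mulrNz -!pmulrn -natr1 opprD.
by rewrite /shift_obj iterS; exact: slicing_shi.
Qed.

Lemma semistable_isom X Y : isom X Y -> semistable sigma X -> semistable sigma Y.
Proof.
move=> e [X0 [phi PX]]; split; last by exists phi; exact: slicing_isom PX.
by move=> /(is_zero_isom (isom_sym e)).
Qed.

Lemma shift_obj_zero X i : is_zero (shift_obj X i) -> is_zero X.
Proof.
move=> /(shift_zero (- i)); apply: is_zero_isom.
by apply: isom_trans (shift_shift _ _ _) _; rewrite subrr; exact: isom_refl.
Qed.

Lemma semistable_shift X i : semistable sigma X -> semistable sigma (shift_obj X i).
Proof.
move=> [X0 [phi PX]]; split; last by exists (phi + i%:~R); exact: slicing_shift.
by move=> /shift_obj_zero.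
Qed.

(** The factors of the slicing axiom may be zero; discarding those keeps the
    phases strictly decreasing. *)
Lemma HN_filt X : ~ is_zero X ->
  exists (phi : nat -> R) (A : nat -> T) (w : seq nat),
    [/\ filt A w X, sorted (fun i j => phi j < phi i) w
      & forall i, i \in w -> ~ is_zero (A i) /\ P (phi i) (A i)].
Proof.
move=> /(slice_HN (slice_slicing sigma))[n [phi [F [A [F0 FX dec FA]]]]].
pose p i := `[< ~ is_zero (A i) >].
exists phi, A, [seq i <- iota 0 n | p i]; split.
- apply: filt_filter.
    by move=> i _ /asboolPn/contrapT.
  have wF k : (k <= n)%N -> filt A (iota 0 k) (F k).
    elim: k => [|k IH] kn //.
    rewrite -addn1 iotaD add0n /=.
    have [_ [f [g [h fgh]]]] := FA k kn.
    apply: (filt_cat (Z := A k)) (IH (ltnW kn)) (filt1 (isom_refl _)).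
    by rewrite addn1; exists f, g, h.
  by rewrite -FX; exact: wF.
- apply: sorted_filter; first by move=> i j k; move=> /[swap]; exact: lt_trans.
  apply/(sortedP 0%N) => i; rewrite size_iota => lt.
  by rewrite !nth_iota ?add0n; [exact: dec| lia|lia].
by move=> i; rewrite mem_filter mem_iota add0n => /andP[/asboolP ? /FA[]].
Qed.

End Slicing.

Section ExceptionalObjects.
Context {K : fieldType} {T : triCat K}.
Implicit Types X Y Z : T.

Lemma homdim_shift2 X Y a b i d : homdim (b + i - a) X Y d ->
  homdim i (shift_obj X a) (shift_obj Y b) d.
Proof.
apply: has_dim_equiv; apply: lin_equiv_trans (lin_equiv_sym (lin_equiv_shift2 _ _ _ _)) _.
by apply: lin_equiv_mor; [exact: isom_refl|apply: isom_sym; exact: shift_shift].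
Qed.

Lemma exceptional_shift X k : exceptional X -> exceptional (shift_obj X k).
Proof.
move=> [X1 X0]; split=> [|i i0]; apply: homdim_shift2; first by rewrite addr0 subrr.
by rewrite addrAC subrr add0r; exact: X0.
Qed.

Lemma exceptional_neq0 X : exceptional X -> ~ is_zero X.
Proof.
move=> [X1 _] /zero_no_morl X0; have [f] := has_dimS_neq0 X1.
by move=> f0; apply: f0; exact: X0.
Qed.

Lemma exceptional_no_mor X i : exceptional X -> i != 0 -> no_mor X (shift_obj X i).
Proof. by move=> [_ X0] /X0/no_mor_homdim. Qed.

Lemma no_mor_shifted (I : Type) (E : I -> T) (x y : I * int) i :
  no_mor (E x.1) (shift_obj (E y.1) (y.2 + i - x.2)) ->
  no_mor (shifted E x) (shift_obj (shifted E y) i).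
Proof. by move=> /no_mor_homdim/homdim_shift2/no_mor_homdim. Qed.

Lemma generated_eq (S S' : set T) :
  S `<=` generated S' -> S' `<=` generated S -> generated S = generated S'.
Proof.
move=> SS' S'S; apply/seteqP; split; apply: generated_sub => //;
  exact: generated_triangulated.
Qed.

Lemma generated_isom (S : set T) X Y : isom X Y -> generated S X -> generated S Y.
Proof. by have [_ + _ _ _] := generated_triangulated S => iso; exact: iso. Qed.

Lemma generated1_shift X Y k :
  isom X (shift_obj Y k) -> generated [set X] = generated [set Y].
Proof.
move=> e; apply: generated_eq => _ ->.
  exact: generated_isom (isom_sym e) (generated_shift k (sub_generated (erefl Y))).
have XY : isom (shift_obj X (- k)) Y.
  apply: isom_trans (shift_isom _ e) _; apply: isom_trans (shift_shift _ _ _) _.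
  by rewrite subrr; exact: isom_refl.
exact: generated_isom XY (generated_shift (- k) (sub_generated (erefl X))).
Qed.

(** The outer maps of the triangle are zero, as h is both mono and epi. *)
Lemma tri_iso_zero X Y Z (f : mor X Y) (g : mor Y Z) (h : mor Z (sh X)) :
  distinguished f g h -> is_iso h -> is_zero Y.
Proof.
move=> fgh [k [kh hk]].
have g0 : g = 0 by rewrite -(comp1m g) -kh -mcompA (tri_comp0 (dist_rot fgh)) mcomp0r.
have f0 : f = 0.
  apply: shm_inj; rewrite shm0; apply/eqP; rewrite -oppr_eq0; apply/eqP.
  by rewrite -[LHS]compm1 -hk mcompA (tri_comp0 (dist_rot (dist_rot fgh))) mcomp0l.
have gE : g \oc idm Y = 0 by rewrite g0 mcomp0l.
by have [v] := tri_lift fgh gE; rewrite f0 mcomp0l.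
Qed.

(** Adjacent factors E_i[k], E_j[m] with k < m can be exchanged, since the
    extension class lies in Hom(E_j, E_i[k+1-m]) and k+1-m <= 0.  If it is not
    zero, then i = j and m = k+1, it is a multiple of an isomorphism and the two
    factors cancel. *)
Lemma shifted_swap (I : eqType) (E : I -> T) (x y : I * int) M :
  (forall i, exceptional (E i)) ->
  (forall i j k, i != j -> k <= 0 -> no_mor (E i) (shift_obj (E j) k)) ->
  x.2 < y.2 -> tri (shifted E x) M (shifted E y) ->
  is_zero M \/ tri (shifted E y) M (shifted E x).
Proof.
case: x y => [i k] [j m] Eexc Eneg /= km t.
have [yx|nyx] := pselect (no_mor (shifted E (j, m)) (sh (shifted E (i, k)))).
  by right; exact: tri_swap.
have [ij mk] : i = j /\ m = k + 1.
  split; apply/eqP; apply: contra_notT nyx => neq.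
    by apply: (@no_mor_shifted _ E (j, m) (i, k) 1); apply: Eneg => /=; [rewrite eq_sym|lia].
  apply: (@no_mor_shifted _ E (j, m) (i, k) 1) => /=.
  have [->|ji] := eqVneq j i; last by apply: Eneg => //; lia.
  by apply: exceptional_no_mor => //; move: neq; apply: contraNneq; lia.
subst j m; have [f [g [h fgh]]] := t.
have [h0|/eqP h0] := eqVneq h 0.
  right; rewrite h0 in fgh.
  exact/biproduct_tri/biproduct_sym/tri_biproduct/fgh.
left; apply: tri_iso_zero fgh _.
have [d1 _] := exceptional_shift (k + 1) (Eexc i).
apply: (nonzero_iso _ d1) => //; first by apply: isom_sym; exact: sh_shift.
exact/exceptional_neq0/exceptional_shift.
Qed.

End ExceptionalObjects.

(** * Phases of sigma-exceptional collections *)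

Section SigmaExceptional.
Context {K : fieldType} {R : realType} {T : triCat K}.
Variable sigma : stability R T.
Context {n : nat} (E : 'I_n -> T).
Hypothesis E_sigma : sigma_exceptional sigma E.
Implicit Types (X Y Z : T) (i j : 'I_n) (x y z : 'I_n * int) (w : seq ('I_n * int)).

Notation P := (slicing sigma).

Lemma sigma_exc i : exceptional (E i).
Proof. by have [[]] := E_sigma. Qed.

Lemma sigma_ortho i j k : (j < i)%N -> no_mor (E i) (shift_obj (E j) k).
Proof. by have [[_ o] _ _ _] := E_sigma => /(o k)/no_mor_homdim. Qed.

Lemma sigma_neg i j k : i != j -> k <= 0 -> no_mor (E i) (shift_obj (E j) k).
Proof. by have [_ _ o _] := E_sigma => /o/[apply]/no_mor_homdim. Qed.

Lemma sigma_ss i : semistable sigma (E i).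
Proof. by have [_ + _ _] := E_sigma. Qed.

Definition letter_phase x : R := phase sigma (E x.1) + x.2%:~R.

Lemma letter_slicing x : P (letter_phase x) (shifted E x).
Proof. exact/slicing_shift/phase_slicing/sigma_ss. Qed.

Lemma letter_neq0 x : ~ is_zero (shifted E x).
Proof. exact/exceptional_neq0/exceptional_shift/sigma_exc. Qed.

Lemma letter_phase_lt x y : x.2 < y.2 -> letter_phase x < letter_phase y.
Proof.
have [_ _ _ [t Et]] := E_sigma.
rewrite -lezD1 -(ler_int R) rmorphD /= /letter_phase.
have /andP[] := Et x.1; have /andP[] := Et y.1; lra.
Qed.

Lemma letter_degree_le x y : letter_phase x <= letter_phase y -> x.2 <= y.2.
Proof. by rewrite leNgt => H; rewrite leNgt; apply: contra H; exact: letter_phase_lt. Qed.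

(** The witnesses x and z are the first and the last letter: if the phase of the
    first one exceeded psi, it would have no morphism to X, and then it would be
    zero by [filt_head_zero]; dually for the last one. *)
Lemma filt_phase (le : rel ('I_n * int)) w X psi :
  total le -> transitive le ->
  (forall x y, le x y -> letter_phase y < letter_phase x + 1) ->
  sorted le w -> filt (shifted E) w X -> P psi X ->
  forall y, y \in w ->
    (exists2 x, le x y & letter_phase x <= psi) /\
    (exists2 z, le y z & psi <= letter_phase z).
Proof.
move=> le_total le_trans le1 w_sorted wX PX y yw.
have le_refl x : le x x by have := le_total x x; rewrite orbb.
split.
- case: w w_sorted wX yw => // x v; rewrite /= path_sortedE // => /andP[/allP xv _] wX yw.
  exists x; first by move: yw; rewrite inE => /orP[/eqP ->|/xv].
  rewrite leNgt; apply/negP => lt; apply: (letter_neq0 (x := x)).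
  apply: filt_head_zero wX _ _; first exact: slicing_no_mor lt (letter_slicing x) PX.
  move=> z /xv/le1 zx.
  exact: slicing_no_mor zx (slicing_sh (letter_slicing x)) (letter_slicing z).
case/lastP: w w_sorted wX yw => // v z; rewrite sorted_pairwise // pairwise_rcons.
move=> /andP[/allP vz _] wX yw; exists z.
  by move: yw; rewrite mem_rcons inE => /orP[/eqP ->|/vz].
rewrite leNgt; apply/negP => lt; apply: (letter_neq0 (x := z)).
apply: filt_last_zero wX _ _; first exact: slicing_no_mor lt PX (letter_slicing z).
move=> x /vz/le1 zx; apply: slicing_no_mor _ (letter_slicing x) (slicing_shi (letter_slicing z)).
by rewrite ltrBlDr.
Qed.

(** A word sorted by decreasing phase is a Harder-Narasimhan filtration up to
    repetition of phases, so a semistable X has a single kind of factor; and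
    an exceptional X, being indecomposable, has one factor only. *)
Lemma increasing_exceptional X :
  {homo (phase sigma \o E) : i j / (i < j)%N >-> i < j} -> full_collection E ->
  exceptional X -> semistable sigma X -> exists x, isom X (shifted E x).
Proof.
move=> inc E_full X_exc X_ss.
have /generated_filt[w0 w0X _] : generated (E @` setT) X by rewrite E_full.
pose le x y := letter_phase y <= letter_phase x.
have trans : transitive le by move=> y x z xy yz; exact: le_trans yz xy.
have swap x y M : ~~ le x y -> tri (shifted E x) M (shifted E y) ->
    is_zero M \/ tri (shifted E y) M (shifted E x).
  rewrite -ltNge => xy t.
  have := letter_degree_le (ltW xy); rewrite le_eqVlt => /orP[/eqP xy2|lt]; last first.
    exact: shifted_swap sigma_exc sigma_neg lt t.
  right; apply: tri_swap t _; apply: (@no_mor_shifted _ _ _ E y x 1); apply: sigma_ortho.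
  move: xy; rewrite /letter_phase xy2 ltrD2r => xy.
  rewrite ltnNge; apply/negP; rewrite leq_eqVlt => /orP[/eqP/val_inj yx|/inc/=].
    by rewrite yx ltxx in xy.
  by rewrite ltNge (ltW xy).
have tot : total le by move=> x y; exact: le_total.
have le1 x y : le x y -> letter_phase y < letter_phase x + 1.
  by move=> /le_lt_trans; apply; rewrite ltrDl.
have [w [w_sorted _ wX]] := filt_sort tot trans swap w0X.
have w_phase y : y \in w -> letter_phase y = phase sigma X.
  move=> yw; have [[x xy Xx] [z yz zX]] :=
    filt_phase tot trans le1 w_sorted wX (phase_slicing X_ss) yw.
  by apply/eqP; rewrite eq_le (le_trans xy Xx) (le_trans zX yz).
case: w w_phase wX {w_sorted} => [_ X0|x v v_phase [Y t vY]]; first by case: X_ss.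
have vx y : y \in v -> y = x.
  move=> yv; have yx : letter_phase y = letter_phase x.
    by rewrite !v_phase ?mem_head // inE yv orbT.
  have yx2 : y.2 = x.2 by apply/eqP; rewrite eq_le !letter_degree_le // yx.
  rewrite [y]surjective_pairing [x]surjective_pairing yx2; congr (_, _).
  move: yx; rewrite /letter_phase yx2 => /addIr yx; apply: val_inj.
  by case: (ltngtP y.1 x.1) => // /inc /=; rewrite yx ltxx.
exists x; have split_t : no_mor Y (sh (shifted E x)).
  apply: filt_no_mor_l vY => y /vx ->.
  apply: (@no_mor_shifted _ _ _ E x x 1).
  by apply: exceptional_no_mor; [exact: sigma_exc|lia].
have XY := tri_split t split_t; have [X1 _] := X_exc.
have [/letter_neq0 //|Y0] := biproduct_indecomposable X1 (exceptional_neq0 X_exc) XY.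
by apply: isom_sym; exact: tri_zero_3 t Y0.
Qed.

End SigmaExceptional.

(** * Left mutations *)

Section Mutation.
Context {K : fieldType} {T : triCat K}.
Implicit Types (X Y Z U V F G : T).

Lemma lin_equiv_bij (V W : lmodType K) (f : V -> W) : linear f ->
  (forall x, f x = 0 -> x = 0) -> (forall y, exists x, f x = y) -> lin_equiv V W.
Proof.
move=> flin inj /choice[g fg]; exists f; split => //; exists g => // x.
apply/eqP; rewrite -subr_eq0; apply/eqP; apply: inj.
have := flin (-1) x (g (f x)); rewrite !scaleN1r => e.
by rewrite addrC e fg addNr.
Qed.

Lemma lin_equiv_post U X Y Z :
  tri X Y Z -> no_mor U X -> no_mor U (sh X) -> lin_equiv (mor U Y) (mor U Z).
Proof.
move=> [f [g [h fgh]]] UX UX1; apply: (lin_equiv_bij (comp_linr g)).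
  by move=> u /(tri_lift fgh)[v <-]; rewrite (UX v) mcomp0r.
by move=> u; apply: (tri_lift (dist_rot fgh)); exact: UX1.
Qed.

Lemma lin_equiv_pre V X Y Z :
  tri X Y Z -> no_mor X V -> no_mor (sh X) V -> lin_equiv (mor Z V) (mor Y V).
Proof.
move=> [f [g [h fgh]]] XV X1V; apply: (lin_equiv_bij (comp_linl g)).
  by move=> u /(tri_extend (dist_rot fgh))[v <-]; rewrite (X1V v) mcomp0l.
by move=> u; apply: (tri_extend fgh); exact: XV.
Qed.

Hypothesis T_proper : proper_cat T.

(** G' is the cone of a nonzero f : F -> G.  As End(F) = K, composition with f is
    injective on End(F), so that passing to G' lowers hom(F, -) by one and
    creates no Hom in degree -1. *)
Lemma mutation_step F G d : exceptional F -> has_dim (mor F G) d.+1 ->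
  (forall k, k != 0 -> no_mor F (shift_obj G k)) ->
  exists G', [/\ tri F G G', has_dim (mor F G') d
    & forall k, k != 0 -> no_mor F (shift_obj G' k)].
Proof.
move=> F_exc FG FGk; have [f f0] := has_dimS_neq0 FG.
have [G' [g [h fgh]]] := tr1_cone f; have t : tri F G G' by exists f, g, h.
have FG'neg : no_mor F (shi G').
  apply/no_mor_shi => u.
  have [F1 _] := exceptional_shift 1 F_exc.
  have [c hu] := has_dim1_span (h \oc u) F1 (exceptional_neq0 (exceptional_shift 1 F_exc)).
  have c0 : c = 0.
    apply/eqP; apply: contra_notT f0 => c0; apply: shm_inj.
    have := mcompA (- shm f) h u.
    rewrite (tri_comp0 (dist_rot (dist_rot fgh))) mcomp0l hu mcompZr compm1.
    move=> /eqP; rewrite scaler_eq0 (negPf c0) oppr_eq0 => /eqP ->.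
    by rewrite shm0.
  rewrite c0 scale0r in hu; have [v <-] := tri_lift (dist_rot fgh) hu.
  have /no_mor_shi/(_ v) -> : no_mor F (shi G) by exact: (FGk (-1)).
  by rewrite mcomp0r.
have FG'k k : k != 0 -> no_mor F (shift_obj G' k).
  move=> k0; have [->|k1] := eqVneq k (-1); first exact: FG'neg.
  apply: no_mor_tri_r (tri_rot (tri_shift k t)) (FGk k k0) _.
  apply: no_mor_isom (isom_refl F) (isom_sym (sh_shift F k)) _.
  by apply: exceptional_no_mor => //; lia.
exists G'; split => //.
have := chi_tri_r T_proper t FG'neg (exceptional_no_mor (i := 2) F_exc isT).
have [F1 _] := F_exc.
rewrite /chi (vdimE FG) (vdimE F1) (vdim_no_mor (FGk 1 isT)) (vdim_no_mor (FG'k 1 isT)).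
rewrite (vdim_no_mor (exceptional_no_mor (i := 1) F_exc isT)) !subr0 => e.
have -> : d = vdim (mor F G') by lia.
exact: mor_vdim.
Qed.

(** L is the left mutation of G through F, built by killing the morphisms F -> G
    one at a time.  The last clause holds because G is an extension of L by copies
    of F: if L has no morphism to F[1], then a copy of F splits off. *)
Lemma left_mutation F G d : exceptional F -> has_dim (mor F G) d ->
  (forall k, k != 0 -> no_mor F (shift_obj G k)) ->
  exists L, [/\ forall k, no_mor F (shift_obj L k),
    forall U, (forall k, no_mor U (shift_obj F k)) ->
      forall k, lin_equiv (mor U (shift_obj G k)) (mor U (shift_obj L k)),
    forall V, (forall k, no_mor F (shift_obj V k)) ->
      forall k, lin_equiv (mor L (shift_obj V k)) (mor G (shift_obj V k)),
    forall A, triangulated_sub A -> A F -> A G -> A L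
  & no_mor L (sh F) -> no_mor G (sh F) /\ ((0 < d)%N -> ~ no_mor G F)].
Proof.
move=> F_exc; elim: d G => [|d IH] G FG FGk.
  exists G; split => //.
  - move=> k; have [->|k0] := eqVneq k 0; last exact: FGk.
    exact/no_mor_dim.
  - by move=> U _ k; exact: lin_equiv_refl.
  - by move=> V _ k; exact: lin_equiv_refl.
have [G' [t FG' FG'k]] := mutation_step F_exc FG FGk.
have [L [FL UL LV AL LF]] := IH G' FG' FG'k.
exists L; split => //.
- move=> U UF k; apply: lin_equiv_trans (UL U UF k).
  apply: lin_equiv_post (tri_shift k t) (UF k) _.
  exact: no_mor_isom (isom_refl U) (isom_sym (sh_shift F k)) (UF (k + 1)).
- move=> V FV k; apply: lin_equiv_trans (LV V FV k) _.
  apply: lin_equiv_pre t (FV k) _; apply/no_mor_shi.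
  exact: no_mor_isom (isom_refl F) (isom_sym (shi_shift V k)) (FV (k - 1)).
- move=> A At AF AG; apply: AL => //.
  by have [_ _ _ _ cone] := At; have [f [g [h fgh]]] := t; exact: cone fgh AF AG.
move=> /LF[G'F _]; split.
  exact: no_mor_tri_l t (exceptional_no_mor (i := 1) F_exc isT) G'F.
move=> _ GF; have [i1 [i2 [p1 [p2 [p1i1 _ _ _ _]]]]] := tri_split t G'F.
by apply: (exceptional_neq0 F_exc); rewrite /is_zero -p1i1 (GF p1) mcomp0l.
Qed.

End Mutation.

(** * Collections with increasing phases *)

Section Increasing.
Context {K : fieldType} {R : realType} {T : triCat K}.
Variable sigma : stability R T.
Context {n : nat} (E : 'I_n -> T).
Hypothesis E_sigma : sigma_exceptional sigma E.
Hypothesis T_proper : proper_cat T.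
Hypothesis E_full : full_collection E.
Hypothesis E_inc : {homo (phase sigma \o E) : i j / (i < j)%N >-> i < j}.

Lemma increasing_derived_points :
  derived_points_ss sigma = [set generated [set E i] | i in setT].
Proof.
apply/seteqP; split=> [_ [X [X_exc X_ss] <-]|_ [i _ <-]].
  have [x Xx] := increasing_exceptional E_sigma E_inc E_full X_exc X_ss.
  by exists x.1 => //; apply/esym; exact: generated1_shift Xx.
by exists (E i) => //; split; [exact: (sigma_exc E_sigma)|exact: sigma_ss].
Qed.

Lemma increasing_semistable_curves l : semistable_curves sigma l = set0.
Proof.
rewrite -subset0 => A [_]; apply; rewrite increasing_derived_points.
apply: sub_finite_set (@subIsetr _ _ _) _.
by apply: finite_image; exact: finite_finset.
Qed.

Lemma letter_ortho (x y : 'I_n * int) (X Y : T) k : (y.1 < x.1)%N ->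
  isom X (shifted E x) -> isom Y (shifted E y) -> no_mor X (shift_obj Y k).
Proof.
move=> yx Xx Yy.
apply: no_mor_isom (isom_sym Xx) (isom_sym (shift_isom k Yy)) _.
by apply: no_mor_shifted; exact: (sigma_ortho E_sigma).
Qed.

(** If F_0, F_1 and the left mutation L of F_1 through F_0 were all shifts of
    members E_a, E_b, E_c of the collection, then a < b as Hom(F_0, F_1) is not
    zero, b <= c as Hom(F_1, L) is not zero, and c <= a as L has a nonzero
    morphism to a shift of F_0. *)
Lemma increasing_stable_curves (l : nat) : stable_curves sigma (Posz l) = set0.
Proof.
rewrite -subset0 => A [[F [d [[F_exc F_ortho] F_strong F01 dl AF]]] A_ss].
set F0 := F ord0 in F01 *; set F1 := F ord_max in F01 *.
have AFi i : A (F i) by rewrite AF; apply: sub_generated; exists i.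
have F10 k : no_mor F1 (shift_obj F0 k) by apply/no_mor_homdim; exact: F_ortho.
have letter X : A X -> exceptional X -> exists x, isom X (shifted E x).
  move=> AX X_exc; apply: (increasing_exceptional E_sigma) => //.
  exact: A_ss (conj AX X_exc).
have F01k k : k != 0 -> no_mor F0 (shift_obj F1 k).
  by move=> k0; apply/no_mor_homdim; exact: F_strong.
have [L [F0L F1L LV AL LF0]] := left_mutation (G := F1) T_proper (F_exc ord0) F01 F01k.
have L_dim k e : homdim k F1 F1 e -> homdim k L L e.
  apply: has_dim_equiv; apply: lin_equiv_trans (F1L F1 F10 k) _.
  by apply: lin_equiv_sym; exact: LV.
have L_exc : exceptional L.
  have [F11 F1k] := F_exc ord_max; split; first exact: L_dim.
  by move=> k /F1k; exact: L_dim.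
have At : triangulated_sub A by rewrite AF; exact: generated_triangulated.
have AL' : A L by exact: AL At (AFi ord0) (AFi ord_max).
have [x F0x] := letter _ (AFi ord0) (F_exc ord0).
have [y F1y] := letter _ (AFi ord_max) (F_exc ord_max).
have [z Lz] := letter _ AL' L_exc.
have xy : (x.1 < y.1)%N.
  rewrite ltnNge leq_eqVlt; apply/negP => /orP[/eqP/val_inj yx|yx].
    have F1F0 : isom F1 (shift_obj F0 (y.2 - x.2)).
      apply: isom_trans F1y _; apply: isom_sym.
      apply: isom_trans (shift_isom _ F0x) _; apply: isom_trans (shift_shift _ _ _) _.
      by rewrite /shifted yx addrC subrK; exact: isom_refl.
    apply: (exceptional_neq0 (F_exc ord_max)); apply: no_mor_zero.
    exact: no_mor_isom (isom_refl F1) (isom_sym F1F0) (F10 (y.2 - x.2)).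
  have /no_mor_dim F01' := letter_ortho (k := 0) yx F0x F1y.
  by have := has_dim_inj F01 F01'; lia.
have yz : (y.1 <= z.1)%N.
  rewrite leqNgt; apply/negP => zy.
  have /no_mor_dim F1L0 := letter_ortho (k := 0) zy F1y Lz.
  have [F11 _] := F_exc ord_max.
  by have := has_dim_inj (has_dim_equiv (F1L F1 F10 0) F11) F1L0.
have [|_] := LF0; first exact: (letter_ortho (k := 1) (leq_trans xy yz) Lz F0x).
by apply; [lia|exact: (F10 0)].
Qed.

End Increasing.

(** * Central charges *)

Section CentralCharge.
Context {K : fieldType} {R : realType} {T : triCat K}.
Variable sigma : stability R T.
Implicit Types X Y Z : T.

Lemma charge_zero X : is_zero X -> charge_of sigma X = 0.
Proof.
move=> X0; have := charge_add sigma (tr1_id X X0) => e.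
by apply: (@addrI _ (charge_of sigma X)); rewrite -e addr0.
Qed.

(** The oriented area spanned by the central charges; its sign compares phases
    which differ by less than 1. *)
Definition area X Y : R :=
  complex.Re (charge_of sigma X) * complex.Im (charge_of sigma Y) -
  complex.Im (charge_of sigma X) * complex.Re (charge_of sigma Y).

Lemma area_sym X Y : area Y X = - area X Y.
Proof. by rewrite /area; ring. Qed.

Lemma area_filt_r (I : Type) (L : I -> T) w X Y :
  filt L w Y -> area X Y = \sum_(x <- w) area X (L x).
Proof.
elim: w Y => [|x w IH] Y /=.
  by move=> Y0; rewrite big_nil /area (charge_zero Y0) /= !mulr0 subr0.
move=> [Z [f [g [h fgh]]] /IH wZ]; rewrite big_cons -wZ /area (charge_add sigma fgh).
case: (charge_of sigma X) (charge_of sigma (L x)) (charge_of sigma Z) => [a b] [c d] [e f'] /=.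
by ring.
Qed.

Lemma area_filt_l (I : Type) (L : I -> T) w X Y :
  filt L w X -> area X Y = \sum_(x <- w) area (L x) Y.
Proof.
move=> wX; rewrite area_sym (area_filt_r _ wX) -sumrN.
by apply: eq_bigr => x _; rewrite -area_sym.
Qed.

Lemma area_phase phi psi X Y :
  ~ is_zero X -> ~ is_zero Y -> slicing sigma phi X -> slicing sigma psi Y ->
  exists2 m : R, 0 < m & area X Y = m * sin (pi * (psi - phi)).
Proof.
move=> X0 Y0 /charge_slice/(_ X0)[a a0 Xa] /charge_slice/(_ Y0)[b b0 Yb].
exists (a * b); first exact: mulr_gt0.
by rewrite /area Xa Yb /= mulrBr sinB; ring.
Qed.

Lemma area_lt0 phi psi X Y :
  ~ is_zero X -> ~ is_zero Y -> slicing sigma phi X -> slicing sigma psi Y ->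
  psi < phi < psi + 1 -> area X Y < 0.
Proof.
move=> X0 Y0 PX PY /andP[lt lt1].
have [m m0 ->] := area_phase X0 Y0 PX PY.
rewrite pmulr_rlt0 // -opprB mulrN sinN oppr_lt0; apply: sin_gt0_pi; apply/andP; split.
  by rewrite mulr_gt0 ?pi_gt0 // subr_gt0.
by rewrite gtr_pMr ?pi_gt0 // ltrBlDr addrC.
Qed.

End CentralCharge.

Lemma sum_two_letters (I : eqType) (V : pzSemiRingType) (f : I -> V) (i j : I) (w : seq I) :
  i != j -> (forall x, x \in w -> x = i \/ x = j) ->
  \sum_(x <- w) f x = f i * (count_mem i w)%:R + f j * (count_mem j w)%:R.
Proof.
move=> ij; elim: w => [|x w IH] xw; first by rewrite big_nil !mulr0 addr0.
rewrite big_cons IH; last by move=> y yw; apply: xw; rewrite inE yw orbT.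
have [->|->] := xw x (mem_head _ _); rewrite /= eqxx.
  by rewrite (negPf ij) /= add0n add1n mulrS mulrDr mulr1 addrA.
by rewrite eq_sym (negPf ij) /= add0n add1n mulrS mulrDr mulr1 addrCA.
Qed.

(** * Words of degree 0 *)

Definition degree_ge (I : Type) (x y : I * int) : bool := y.2 <= x.2.

Lemma degree_ge_total (I : Type) : total (@degree_ge I).
Proof. by move=> x y; exact: le_total. Qed.

Lemma degree_ge_trans (I : Type) : transitive (@degree_ge I).
Proof. by move=> y x z xy yz; exact: le_trans yz xy. Qed.

Section HeartWords.
Context {K : fieldType} {R : realType} {T : triCat K}.
Variable sigma : stability R T.
Context {n : nat} (E : 'I_n -> T).
Hypothesis E_sigma : sigma_exceptional sigma E.
Implicit Types (X Y Z : T) (a b m : 'I_n) (v w : seq 'I_n).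

Notation P := (slicing sigma).

Lemma sigma_no_mor_neg a b k : k < 0 -> no_mor (E a) (shift_obj (E b) k).
Proof.
move=> k0; have [->|ab] := eqVneq a b.
  by apply: exceptional_no_mor; [exact: (sigma_exc E_sigma)|rewrite lt_eqF].
by apply: (sigma_neg E_sigma) => //; exact: ltW.
Qed.

Lemma sigma_no_mor_1 a b : (b <= a)%N -> no_mor (E a) (sh (E b)).
Proof.
rewrite leq_eqVlt => /orP[/eqP/val_inj ->|ba].
  by apply: (exceptional_no_mor (i := 1)); [exact: (sigma_exc E_sigma)|].
exact: (sigma_ortho E_sigma (k := 1)).
Qed.

Lemma degree_filt X (w0 : seq ('I_n * int)) : filt (shifted E) w0 X ->
  exists w : seq ('I_n * int),
  [/\ sorted (@degree_ge _) w, {subset w <= w0} & filt (shifted E) w X].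
Proof.
apply: filt_sort; [exact: degree_ge_total|exact: degree_ge_trans|].
move=> x y M; rewrite /degree_ge -ltNge.
exact: shifted_swap (sigma_exc E_sigma) (sigma_neg E_sigma).
Qed.

Lemma filt_degree0 X d (w : seq ('I_n * int)) :
  (forall x, x \in w -> x.2 = d) -> filt (shifted E) w X ->
  filt E [seq x.1 | x <- w] (shift_obj X (- d)).
Proof.
move=> wd /(filt_shift (- d)); apply: filt_map => x /wd xd.
apply: isom_trans (shift_shift _ _ _) _; rewrite xd subrr; exact: isom_refl.
Qed.

(** The phase window forces the first letter of a word sorted by degree to have
    degree at most 0, and the last letter to have degree at least 0. *)
Lemma heart_filt (t : R) psi X : full_collection E ->
  (forall a, t < phase sigma (E a) <= t + 1) ->
  t < psi <= t + 1 -> P psi X -> exists v, filt E v X.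
Proof.
move=> E_full Et /andP[t_psi psi_t] PX.
have /generated_filt[w0 w0X _] : generated (E @` setT) X by rewrite E_full.
have [w [w_sorted _ wX]] := degree_filt w0X.
have le1 x y : degree_ge x y -> letter_phase sigma E y < letter_phase sigma E x + 1.
  move=> xy; have -> : letter_phase sigma E x + 1 = letter_phase sigma E (x.1, x.2 + 1).
    by rewrite /letter_phase /= rmorphD /= addrA.
  apply: (letter_phase_lt E_sigma); rewrite /= ltzD1; exact: xy.
exists [seq x.1 | x <- w]; apply: (filt_degree0 (d := 0)) (wX) => y yw.
have [[x xy Xx] [z yz zX]] :=
  filt_phase E_sigma (@degree_ge_total _) (@degree_ge_trans _) le1 w_sorted wX PX yw.
have x0 : x.2 < 1.
  rewrite -(ltr_int R) rmorph1; move: Xx; rewrite /letter_phase.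
  have /andP[] := Et x.1; lra.
have z0 : -1 < z.2.
  rewrite -(ltr_int R) rmorphN rmorph1; move: zX; rewrite /letter_phase.
  have /andP[] := Et z.1; lra.
apply/eqP; rewrite eq_le -ltzD1 (le_lt_trans xy x0) /=.
by rewrite (le_trans _ yz) // -ltzD1 -ltrBlDr sub0r.
Qed.

(** The first factor has a nonzero morphism to some E_a, and some E_a has one to
    the last factor. *)
Lemma HN_bounds (t : R) X v (phi : nat -> R) (A : nat -> T) (w : seq nat) :
  (forall a, t < phase sigma (E a) <= t + 1) -> filt E v X ->
  filt A w X -> sorted (fun k l => phi l < phi k) w ->
  (forall k, k \in w -> ~ is_zero (A k) /\ P (phi k) (A k)) ->
  forall k, k \in w -> t < phi k <= t + 1.
Proof.
move=> Et vX wX w_sorted wA k kw.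
have trans : transitive (fun k l => phi l < phi k).
  by move=> ? ? ? /[swap]; exact: lt_trans.
have PE a : P (phase sigma (E a)) (E a) by exact/phase_slicing/sigma_ss.
apply/andP; split.
- case/lastP: w wX w_sorted wA kw => // w z wX.
  rewrite sorted_pairwise // pairwise_rcons => /andP[/allP wz _] wA kw.
  have zw : z \in rcons w z by rewrite mem_rcons mem_head.
  suff tz : t < phi z.
    move: kw; rewrite mem_rcons inE => /orP[/eqP -> //|/wz]; exact: lt_trans.
  rewrite ltNge; apply/negP => zt; apply: (proj1 (wA _ zw)).
  apply: filt_last_zero wX _ _.
    apply: filt_no_mor_l vX => a _.
    have /andP[ta _] := Et a.
    exact: slicing_no_mor (le_lt_trans zt ta) (PE a) (proj2 (wA _ zw)).
  move=> y yw; have yw' : y \in rcons w z by rewrite mem_rcons inE yw orbT.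
  apply: slicing_no_mor _ (proj2 (wA _ yw')) (slicing_shi (proj2 (wA _ zw))).
  have := wz _ yw; lra.
case: w wX w_sorted wA kw => // y w wX.
rewrite /= path_sortedE // => /andP[/allP yw _] wA kw.
have yw' : y \in y :: w by rewrite mem_head.
suff yt : phi y <= t + 1.
  by move: kw; rewrite inE => /orP[/eqP -> //|/yw /ltW ky]; exact: le_trans ky yt.
rewrite leNgt; apply/negP => ty; apply: (proj1 (wA _ yw')).
apply: filt_head_zero wX _ _.
  apply: filt_no_mor_r vX => a _; have /andP[_ ta] := Et a.
  exact: slicing_no_mor (le_lt_trans ta ty) (proj2 (wA _ yw')) (PE a).
move=> z zw; have zw' : z \in y :: w by rewrite inE zw orbT.
apply: slicing_no_mor _ (slicing_sh (proj2 (wA _ yw'))) (proj2 (wA _ zw')).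
have := yw _ zw; lra.
Qed.

Lemma filt_trans (I : eqType) (A : I -> T) (w : seq I) Z :
  (forall k, k \in w -> exists v, filt E v (A k)) -> filt A w Z -> exists v, filt E v Z.
Proof.
elim: w Z => [|k w IH] Z wE /=; first by exists [::].
move=> [Y t wY]; have [v vA] := wE _ (mem_head _ _).
have [|u uY] := IH Y _ wY; first by move=> l lw; apply: wE; rewrite inE lw orbT.
by exists (v ++ u); exact: filt_cat t vA uY.
Qed.

(** Let m be the largest letter of both words.  On objects with letters at most m,
    Hom^k(E_m, -) vanishes for k <> 0 and Hom(E_m, -) detects the letter m; so if
    Hom(E_m, X) = 0, then m occurs neither in Y nor in Z. *)
Lemma letter_le_max (j : nat) vY vZ X Y Z :
  tri Y X Z -> filt E vY Y -> filt E vZ Z ->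
  (forall m, (j < m)%N -> no_mor (E m) X) ->
  forall m, m \in vY ++ vZ -> (m <= j)%N.
Proof.
move=> t YE ZE XE m0 m0w; rewrite leqNgt; apply/negP => jm0.
have [m mw m_max] := @arg_maxnP _ m0 (mem (vY ++ vZ)) val m0w.
have jm : (j < m)%N by apply: leq_trans jm0 (m_max _ m0w).
have detect v V : filt E v V -> (forall a, a \in v -> (a <= m)%N) ->
    no_mor (E m) V -> m \notin v.
  elim: v V => // x v IH V [W tV vW] v_max mV.
  have v_max' a : a \in v -> (a <= m)%N by move=> av; apply: v_max; rewrite inE av orbT.
  rewrite inE negb_or; apply/andP; split; last first.
    apply: (IH W) => //; apply: no_mor_tri_r (tri_rot tV) mV _.
    by apply: sigma_no_mor_1; apply: v_max; rewrite mem_head.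
  apply/eqP => mx; apply: (exceptional_neq0 (sigma_exc E_sigma m)).
  apply: no_mor_zero; rewrite {2}mx; apply: no_mor_tri_r (tri_unrot tV) _ mV.
  apply: (filt_no_mor_r (L := fun a => shi (E a))) (filt_shift (-1) vW) => a _.
  exact: (sigma_no_mor_neg (k := -1)).
have vY_max a : a \in vY -> (a <= m)%N.
  by move=> aY; apply: m_max; rewrite inE mem_cat aY.
have vZ_max a : a \in vZ -> (a <= m)%N.
  by move=> aZ; apply: m_max; rewrite inE mem_cat aZ orbT.
have mw' : m \in vY ++ vZ by [].
move: mw'; rewrite mem_cat; apply/negP; rewrite negb_or; apply/andP; split.
  apply: detect YE vY_max _; apply: no_mor_tri_r (tri_unrot t) _ (XE m jm).
  apply: (filt_no_mor_r (L := fun a => shi (E a))) (filt_shift (-1) ZE) => a _.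
  exact: (sigma_no_mor_neg (k := -1)).
apply: detect ZE vZ_max _; apply: no_mor_tri_r (tri_rot t) (XE m jm) _.
apply: (filt_no_mor_r (L := fun a => sh (E a))) (filt_shift 1 YE) => a aY.
exact/sigma_no_mor_1/vY_max.
Qed.

(** The dual argument, with Hom(-, E_m) and the smallest letter m. *)
Lemma letter_ge_min (i : nat) vY vZ X Y Z :
  tri Y X Z -> filt E vY Y -> filt E vZ Z ->
  (forall m, (m < i)%N -> no_mor X (E m)) ->
  forall m, m \in vY ++ vZ -> (i <= m)%N.
Proof.
move=> t YE ZE XE m0 m0w; rewrite leqNgt; apply/negP => m0i.
have [m mw m_min] := @arg_minnP _ m0 (mem (vY ++ vZ)) val m0w.
have mi : (m < i)%N by apply: leq_ltn_trans (m_min _ m0w) m0i.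
have detect v V : filt E v V -> (forall a, a \in v -> (m <= a)%N) ->
    no_mor V (E m) -> m \notin v.
  elim: v V => // x v IH V [W tV vW] v_min mV.
  have v_min' a : a \in v -> (m <= a)%N by move=> av; apply: v_min; rewrite inE av orbT.
  rewrite inE negb_or; apply/andP; split; last first.
    apply: (IH W) => //; apply: no_mor_tri_l (tri_rot tV) mV _.
    by apply/no_mor_shi; exact: (sigma_no_mor_neg (k := -1)).
  apply/eqP => mx; apply: (exceptional_neq0 (sigma_exc E_sigma m)).
  apply: no_mor_zero; rewrite {1}mx; apply: no_mor_tri_l (tri_unrot tV) _ mV.
  apply/no_mor_sh; apply: filt_no_mor_l vW => a av; exact/sigma_no_mor_1/v_min'.
have vY_min a : a \in vY -> (m <= a)%N.
  by move=> aY; apply: m_min; rewrite inE mem_cat aY.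
have vZ_min a : a \in vZ -> (m <= a)%N.
  by move=> aZ; apply: m_min; rewrite inE mem_cat aZ orbT.
have mw' : m \in vY ++ vZ by [].
move: mw'; rewrite mem_cat; apply/negP; rewrite negb_or; apply/andP; split.
  apply: detect YE vY_min _; apply: no_mor_tri_l (tri_unrot t) _ (XE m mi).
  apply/no_mor_sh; apply: filt_no_mor_l ZE => a aZ; exact/sigma_no_mor_1/vZ_min.
apply: detect ZE vZ_min _; apply: no_mor_tri_l (tri_rot t) (XE m mi) _.
apply/no_mor_shi; apply: filt_no_mor_l YE => a _.
exact: (sigma_no_mor_neg (k := -1)).
Qed.

End HeartWords.

(** * Exceptional pairs with one nonzero Ext group *)

Section ExtPair.
Context {K : fieldType} {R : realType} {T : triCat K}.
Variable sigma : stability R T.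
Context {n : nat} (E : 'I_n -> T).
Hypothesis E_sigma : sigma_exceptional sigma E.
Hypothesis T_proper : proper_cat T.
Hypothesis E_full : full_collection E.
Variables (i j : 'I_n) (l : nat).
Hypothesis ij : nat_of_ord j = (nat_of_ord i).+1.
Hypothesis E_hom1 : homdim 1 (E i) (E j) l.+1.
Hypothesis E_homk : forall k : int, k != 1 -> homdim k (E i) (E j) 0.
Hypothesis E_phase : phase sigma (E j) <= phase sigma (E i).
Implicit Types (X Y Z : T) (a b m : 'I_n) (v w : seq 'I_n).

Notation P := (slicing sigma).
Notation in_pair v := (forall a, a \in v -> a = i \/ a = j).

Lemma ij_neq : i != j.
Proof. by apply/eqP => e; move: ij; rewrite e; lia. Qed.

Lemma pair_no_mor_ge2 a b k : a = i \/ a = j -> b = i \/ b = j -> 2 <= k ->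
  no_mor (E a) (shift_obj (E b) k).
Proof.
move=> [->|->] [->|->] k2.
- by apply: exceptional_no_mor; [exact: (sigma_exc E_sigma)|lia].
- by apply/no_mor_homdim; apply: E_homk; lia.
- by apply: (sigma_ortho E_sigma); rewrite ij.
by apply: exceptional_no_mor; [exact: (sigma_exc E_sigma)|lia].
Qed.

(** The blocks of equal degree in a sorted filtration split off, since the
    E_i, E_j have no Hom of degree at least 2 between each other. *)
Lemma pair_exceptional_filt X : exceptional X -> generated [set E i; E j] X ->
  exists k v, in_pair v /\ filt E v (shift_obj X k).
Proof.
move=> X_exc; have -> : [set E i; E j] = E @` [set i; j].
  apply/seteqP; split=> [_ [->|->]|_ [a [->|->] <-]]; [|by exists j; [right|]|by left|by right].
  by exists i; [left|].
move=> /generated_filt[w0 w0X w0ij].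
have [w [w_sorted /(_ _)/[dup] w_sub _ wX]] := degree_filt E_sigma w0X.
have {w0 w0X w0ij w_sub} wij x : x \in w -> x.1 = i \/ x.1 = j by move=> /w_sub/w0ij.
have [N] := ubnP (size w); elim: N w w_sorted wX wij => // N IH w w_sorted wX wij wN.
case: w w_sorted wX wij wN => [_ X0 _ _|x w].
  by case: (exceptional_neq0 X_exc).
move=> w_sorted wX wij wN.
have deg y : y \in w -> y.2 <= x.2.
  by move: w_sorted; rewrite /= (path_sortedE (@degree_ge_trans _)) => /andP[/allP + _]; exact.
have [|] := boolP (has (fun y => y.2 != x.2) w); last first.
  move=> /hasPn wx; exists (- x.2), [seq y.1 | y <- x :: w]; split.
    by move=> _ /mapP[y yw ->]; exact: wij.
  by apply: filt_degree0 wX => y; rewrite inE => /orP[/eqP ->|/wx/negPn/eqP].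
move=> w_has; have [z [s1 [s2 [wE zx s1x]]]] : exists z s1 s2,
    [/\ w = s1 ++ z :: s2, z.2 != x.2 & ~~ has (fun y => y.2 != x.2) s1].
  by case: (split_find w_has) => z s1 s2 zx s1x; exists z, s1, s2; rewrite cat_rcons.
have s1_deg y : y \in x :: s1 -> y.2 = x.2.
  by rewrite inE => /orP[/eqP -> //|ys]; apply/eqP; move/hasPn/(_ _ ys)/negPn: s1x.
have zs_sorted : sorted (@degree_ge _) (z :: s2).
  by move: w_sorted => /path_sorted; rewrite wE => /cat_sorted2[].
have zs_deg y : y \in z :: s2 -> y.2 < x.2.
  have zx' : z.2 < x.2 by rewrite lt_neqAle zx deg // wE mem_cat mem_head orbT.
  rewrite inE => /orP[/eqP -> //|ys]; apply: le_lt_trans zx'.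
  by move: zs_sorted; rewrite /= (path_sortedE (@degree_ge_trans _)) => /andP[/allP/(_ _ ys)].
have wij1 y : y \in x :: s1 -> y.1 = i \/ y.1 = j.
  by move=> ys; apply: wij; rewrite wE -cat_cons mem_cat ys.
have wij2 y : y \in z :: s2 -> y.1 = i \/ y.1 = j.
  by move=> ys; apply: wij; rewrite wE -cat_cons mem_cat ys orbT.
have [X1 [X2 [t X1w X2w]]] : exists X1 X2,
    [/\ tri X1 X X2, filt (shifted E) (x :: s1) X1 & filt (shifted E) (z :: s2) X2].
  by apply: filt_split; rewrite cat_cons -wE.
have X21 : no_mor X2 (shift_obj X1 1).
  apply: filt_no_mor X2w X1w => y y' ys ys'; apply: no_mor_shifted.
  apply: pair_no_mor_ge2 (wij2 y ys) (wij1 y' ys') _; rewrite (s1_deg y' ys').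
  by move: (zs_deg y ys); move: x.2 y.2 => p q; lia.
have [X_one _] := X_exc.
have [X1_0|X2_0] :=
  biproduct_indecomposable X_one (exceptional_neq0 X_exc) (tri_split t X21).
  have X2X : isom X2 X by apply: isom_sym; exact: tri_zero_1 t X1_0.
  apply: (IH (z :: s2)) => //; first exact: filt_isom X2X X2w.
  by move: wN; rewrite wE /= !ltnS size_cat /=; lia.
exists (- x.2), [seq y.1 | y <- x :: s1]; split.
  by move=> _ /mapP[y yw ->]; exact: wij1.
apply: filt_isom (filt_degree0 s1_deg X1w).
exact: shift_isom (tri_zero_3 t X2_0).
Qed.

Lemma chi_pair v w X Y : in_pair v -> in_pair w -> filt E v X -> filt E w Y ->
  chi X Y = (count_mem i v)%:Z * (count_mem i w)%:Z +
            (count_mem j v)%:Z * (count_mem j w)%:Z -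
            (l.+1)%:Z * ((count_mem i v)%:Z * (count_mem j w)%:Z).
Proof.
move=> v_ij w_ij vX wY.
have chi_a a : a = i \/ a = j -> chi (E a) Y =
    chi (E a) (E i) * (count_mem i w)%:R + chi (E a) (E j) * (count_mem j w)%:R.
  move=> aij; rewrite (chi_filt_r T_proper _ _ wY).
  - exact: sum_two_letters ij_neq w_ij.
  - by move=> b _; exact: (sigma_no_mor_neg (k := -1) E_sigma).
  - by move=> b /w_ij bij; exact: (pair_no_mor_ge2 (k := 2)).
rewrite (chi_filt_l T_proper _ _ vX).
- rewrite (sum_two_letters _ ij_neq v_ij) !chi_a; [|by right|by left].
  have [[Ei1 Eik] [Ej1 Ejk]] := (sigma_exc E_sigma i, sigma_exc E_sigma j).
  have -> : chi (E i) (E i) = 1 by rewrite /chi (vdimE Ei1) (vdimE (Eik 1 isT)).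
  have -> : chi (E j) (E j) = 1 by rewrite /chi (vdimE Ej1) (vdimE (Ejk 1 isT)).
  have -> : chi (E i) (E j) = - (l.+1)%:Z.
    by rewrite /chi (vdimE E_hom1) (vdimE (E_homk (k := 0) isT)) sub0r.
  have -> : chi (E j) (E i) = 0.
    have ji k : no_mor (E j) (shift_obj (E i) k).
      by apply: (sigma_ortho E_sigma); rewrite ij.
    by rewrite /chi (vdim_no_mor (ji 0)) (vdim_no_mor (ji 1)).
  by rewrite !natz; ring.
- move=> a _; apply/no_mor_shi; apply: filt_no_mor_r (filt_shift (-1) wY) => b _.
  exact: (sigma_no_mor_neg (k := -1) E_sigma).
move=> a /v_ij aij; apply: filt_no_mor_r (filt_shift 2 wY) => b /w_ij bij.
exact: (pair_no_mor_ge2 (k := 2)).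
Qed.

Lemma area_pair v w Y Z : in_pair v -> in_pair w -> filt E v Y -> filt E w Z ->
  area sigma Y Z = area sigma (E i) (E j) *
    ((count_mem i v)%:R * (count_mem j w)%:R - (count_mem j v)%:R * (count_mem i w)%:R).
Proof.
move=> v_ij w_ij vY wZ.
have area0 a : area sigma (E a) (E a) = 0 by rewrite /area; ring.
have area_a a : area sigma (E a) Z =
    area sigma (E a) (E i) * (count_mem i w)%:R +
    area sigma (E a) (E j) * (count_mem j w)%:R.
  by rewrite (area_filt_r _ _ wZ) (sum_two_letters _ ij_neq w_ij).
rewrite (area_filt_l _ _ vY) (sum_two_letters _ ij_neq v_ij) !area_a !area0.
by rewrite (area_sym sigma (E i) (E j)); ring.
Qed.

(** Hom^2 vanishes between iterated extensions of E_i and E_j, so that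
    Hom^1(X, X) = 0 surjects onto Hom^1(Y, X), Hom^1(X, Z) and Hom^1(Y, Z).  As
    Hom(Y, Z) = 0, the first two contain Hom^1(Y, Y) and Hom^1(Z, Z). *)
Lemma rigid_factors v w Y X Z : in_pair v -> in_pair w ->
  filt E v Y -> filt E w Z -> tri Y X Z -> no_mor Y Z -> no_mor X (sh X) ->
  [/\ no_mor Y (sh Z), no_mor Y (sh Y) & no_mor Z (sh Z)].
Proof.
move=> v_ij w_ij vY wZ t YZ XX.
have hom2 v1 v2 U V : in_pair v1 -> in_pair v2 -> filt E v1 U -> filt E v2 V ->
    no_mor U (sh (sh V)).
  move=> v1_ij v2_ij Uv Vv; apply: (filt_no_mor (k := 2)) Uv Vv => a b /v1_ij ? /v2_ij ?.
  exact: pair_no_mor_ge2.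
have vw_ij : in_pair (v ++ w) by move=> a; rewrite mem_cat => /orP[/v_ij|/w_ij].
have Xvw : filt E (v ++ w) X := filt_cat t vY wZ.
have XYZ : tri (sh X) (sh Z) (sh (sh Y)) := tri_rot (tri_sh t).
have YX : no_mor Y (sh X).
  apply: no_mor_tri_l (tri_unrot t) _ XX; apply/no_mor_sh.
  exact: hom2 w_ij vw_ij wZ Xvw.
split.
- exact: no_mor_tri_r XYZ YX (hom2 _ _ _ _ v_ij v_ij vY vY).
- exact: no_mor_tri_r (tri_rot (tri_rot t)) YZ YX.
apply: no_mor_tri_l (tri_rot t) _ (no_mor_equiv (lin_equiv_sh _ _) YZ).
exact: no_mor_tri_r XYZ XX (hom2 _ _ _ _ vw_ij v_ij Xvw vY).
Qed.

Lemma chi_rigid_ge1 X : ~ is_zero X -> no_mor X (sh X) -> 1 <= chi X X.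
Proof.
move=> X0 XX; rewrite /chi (vdim_no_mor XX) subr0 lez_nat lt0n.
apply/eqP => XX0; apply: X0; apply: no_mor_zero; apply/no_mor_dim.
by rewrite -XX0; exact: mor_vdim.
Qed.

(** Otherwise let Y -> X -> Z start the Harder-Narasimhan filtration of X.  Then Y
    and Z are rigid with Hom^*(Y, Z) = 0, so chi(X,X) = chi(Y,Y) + chi(Z,Z) +
    chi(Z,Y) with chi(Y,Y), chi(Z,Z) >= 1, while chi(Z,Y) = chi(Z,Y) - chi(Y,Z)
    is positive because Y has larger phase than Z. *)
Lemma pair_exceptional_semistable X v : exceptional X -> in_pair v -> filt E v X ->
  semistable sigma X.
Proof.
move=> X_exc v_ij vX; have X0 := exceptional_neq0 X_exc.
have [_ _ _ [t Et]] := E_sigma.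
have [phi [A [w [wX w_sorted wA]]]] := HN_filt sigma X0.
have w_phi := HN_bounds E_sigma Et vX wX w_sorted wA.
case: w wX w_sorted wA w_phi => [/X0 //|y w [Z tri_yZ wZ] w_sorted wA w_phi].
have [Ay0 PAy] := wA y (mem_head _ _).
have [Z0|Z0] := pselect (is_zero Z).
  apply: (semistable_isom (tri_zero_3 tri_yZ Z0)).
  by split => //; exists (phi y).
exfalso.
have wy k : k \in w -> phi k < phi y.
  have trans : transitive (fun k l => phi l < phi k).
    by move=> ? ? ? /[swap]; exact: lt_trans.
  by move: w_sorted; rewrite /= path_sortedE // => /andP[/allP + _]; exact.
have w_in k : k \in w -> k \in y :: w by rewrite inE orbC => ->.
have w_heart k : k \in y :: w -> exists u, filt E u (A k).
  by move=> kw; have [_ PAk] := wA k kw; have := heart_filt E_sigma E_full Et (w_phi k kw) PAk.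
have [vY vYE] := w_heart y (mem_head _ _).
have [vZ vZE] : exists u, filt E u Z.
  by apply: filt_trans wZ => k /w_in; exact: w_heart.
have i_min : forall m, m \in vY ++ vZ -> (i <= m)%N.
  apply: (letter_ge_min E_sigma tri_yZ vYE vZE) => m mi.
  apply: filt_no_mor_l vX => a /v_ij aij; apply: (sigma_ortho E_sigma (k := 0)).
  by case: aij => ->; [|rewrite ij ltnW].
have j_max : forall m, m \in vY ++ vZ -> (m <= j)%N.
  apply: (letter_le_max E_sigma tri_yZ vYE vZE) => m jm.
  apply: filt_no_mor_r vX => a /v_ij aij; apply: (sigma_ortho E_sigma (k := 0)).
  by case: aij => ->; [apply: leq_ltn_trans jm; rewrite ij|].
have YZ_ij : in_pair (vY ++ vZ).
  move=> a aw; have := i_min a aw; have := j_max a aw; rewrite ij => aj ai.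
  by have [e|e] : val a = val i \/ val a = val j; [rewrite /= ij; lia| |];
    [left|right]; exact: val_inj.
have vY_ij : in_pair vY by move=> a aY; apply: YZ_ij; rewrite mem_cat aY.
have vZ_ij : in_pair vZ by move=> a aZ; apply: YZ_ij; rewrite mem_cat aZ orbT.
have AyZ : no_mor (A y) Z.
  apply: filt_no_mor_r wZ => k kw; have [_ PAk] := wA k (w_in k kw).
  exact: slicing_no_mor (wy k kw) PAy PAk.
have XX1 : no_mor X (sh X) := exceptional_no_mor (i := 1) X_exc isT.
have [YZ YY ZZ] := rigid_factors vY_ij vZ_ij vYE vZE tri_yZ AyZ XX1.
have XE : filt E (vY ++ vZ) X := filt_cat tri_yZ vYE vZE.
have chiX : chi X X = 1.
  by have [X1 _] := X_exc; rewrite /chi (vdimE X1) (vdim_no_mor XX1).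
have chiYZ : chi (A y) Z = 0 by rewrite /chi (vdim_no_mor AyZ) (vdim_no_mor YZ).
have chiY := chi_rigid_ge1 Ay0 YY; have chiZ := chi_rigid_ge1 Z0 ZZ.
have areaYZ : area sigma (A y) Z < 0.
  rewrite (area_filt_r _ _ wZ); have neg k : k \in w -> area sigma (A y) (A k) < 0.
    move=> kw; have [Ak0 PAk] := wA k (w_in k kw); apply: (area_lt0 Ay0 Ak0 PAy PAk).
    rewrite wy //=; have /andP[_ +] := w_phi y (mem_head _ _).
    have /andP[+ _] := w_phi k (w_in k kw); lra.
  case: w wZ neg {w_sorted wA w_phi wy w_in w_heart} => [/Z0 //|k w _ neg].
  rewrite big_cons -[ltRHS]addr0; apply: ltr_leD; first by apply: neg; rewrite mem_head.
  by rewrite big_seq; apply: sumr_le0 => k' kw; apply/ltW/neg; rewrite inE kw orbT.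
have area_ij : area sigma (E i) (E j) <= 0.
  have [Ei0 Ej0] := (exceptional_neq0 (sigma_exc E_sigma i), exceptional_neq0 (sigma_exc E_sigma j)).
  have [Pi Pj] := (phase_slicing (sigma_ss E_sigma i), phase_slicing (sigma_ss E_sigma j)).
  have [e|lt] := eqVneq (phase sigma (E j)) (phase sigma (E i)).
    by have [m _ ->] := area_phase Ei0 Ej0 Pi Pj; rewrite e subrr mulr0 sin0 mulr0.
  apply/ltW/(area_lt0 Ei0 Ej0 Pi Pj); rewrite lt_neqAle lt E_phase /=.
  by have /andP[_ +] := Et i; have /andP[+ _] := Et j; lra.
(* E_i has at least the phase of E_j, so Y, of larger phase than Z, has the
   larger proportion of letters i *)
move: areaYZ; rewrite (area_pair vY_ij vZ_ij vYE vZE) => areaYZ.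
have slope : (count_mem j vY)%:Z * (count_mem i vZ)%:Z <
             (count_mem i vY)%:Z * (count_mem j vZ)%:Z.
  rewrite -(ltr_int R) !rmorphM /= -subr_gt0 ltNge; apply/negP => le0.
  by move: areaYZ; rewrite ltNge mulr_le0.
move: chiX chiYZ chiY chiZ slope.
rewrite (chi_pair YZ_ij YZ_ij XE XE) (chi_pair vY_ij vZ_ij vYE vZE).
rewrite (chi_pair vY_ij vY_ij vYE vYE) (chi_pair vZ_ij vZ_ij vZE vZE).
rewrite !count_cat !PoszD.
move: (count_mem i vY)%:Z (count_mem j vY)%:Z (count_mem i vZ)%:Z (count_mem j vZ)%:Z.
move=> a b c d qX qYZ qY qZ adbc.
have pos : 0 < (l.+1)%:Z * (a * d - b * c) by rewrite mulr_gt0 // subr_gt0.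
move: pos qX qYZ qY qZ; move: (Posz l.+1) => L pos qX qYZ qY qZ.
suff : 2 < (a + c) * (a + c) + (b + d) * (b + d) - L * ((a + c) * (b + d)) by rewrite qX.
have -> : (a + c) * (a + c) + (b + d) * (b + d) - L * ((a + c) * (b + d)) =
  (a * a + b * b - L * (a * b)) + (c * c + d * d - L * (c * d)) +
  2 * (a * c + b * d - L * (a * d)) + L * (a * d - b * c) by ring.
by rewrite qYZ mulr0 addr0 -[2]addr0; apply: ler_ltD => //; exact: lerD.
Qed.

Lemma pair_stable_curve : stable_curves sigma (Posz l) (generated [set E i; E j]).
Proof.
have gen_sh : generated [set E i; E j] (sh (E j)).
  by apply: (generated_shift 1); apply: sub_generated; right.
split; last first.
  move=> X [AX X_exc]; have [k [v [v_ij vX]]] := pair_exceptional_filt X_exc AX.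
  have := pair_exceptional_semistable (exceptional_shift k X_exc) v_ij vX.
  move=> /(semistable_shift (- k)); apply: semistable_isom.
  by apply: isom_trans (shift_shift _ _ _) _; rewrite subrr; exact: isom_refl.
have [Ei_exc Ej_exc] := (sigma_exc E_sigma i, sigma_exc E_sigma j).
pose F (o : 'I_2) := if o == ord0 then E i else sh (E j).
have Fj_exc : exceptional (sh (E j)) := exceptional_shift 1 Ej_exc.
have F_exc o : exceptional (F o) by rewrite /F; case: ifP.
have ortho k : homdim k (sh (E j)) (E i) 0.
  apply: (homdim_shift2 (a := 1) (b := 0)); apply/no_mor_homdim.
  by apply: (sigma_ortho E_sigma); rewrite ij.
have hom01 k d : homdim (k + 1) (E i) (E j) d -> homdim k (E i) (sh (E j)) d.
  by move=> h; apply: (homdim_shift2 (a := 0) (b := 1)); rewrite subr0 addrC.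
have ord2 (o : 'I_2) : o = ord0 \/ o = ord_max.
  by case: o => [[|[|//]] lt]; [left|right]; exact: val_inj.
exists F, l.+1; split.
- split=> [a|k a b]; first exact: F_exc.
  by have [->|->] := ord2 a; have [->|->] := ord2 b => // _; exact: (ortho k).
- move=> a b k k0; have [->|->] := ord2 a; have [->|->] := ord2 b.
  + exact: (proj2 Ei_exc).
  + by apply: hom01; apply: E_homk; lia.
  + exact: ortho.
  + exact: (proj2 Fj_exc).
- exact: (hom01 0 _ E_hom1).
- by rewrite -addn1 PoszD.
apply: generated_eq.
  move=> _ [->|->]; first by apply: sub_generated; exists ord0.
  apply: (generated_isom (shi_sh (E j))).
  by apply: (generated_shift (-1)); apply: sub_generated; exists ord_max.
move=> _ [p _ <-]; have [->|->] := ord2 p; last exact: gen_sh.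
by apply: sub_generated; left.
Qed.

End ExtPair.

Theorem proposition3 (K : fieldType) (R : realType) (T : triCat K)
    (sigma : stability R T) (n : nat) (E : 'I_n.+1 -> T)
    (T_proper : proper_cat T) (T_enh : has_enhancement T)
    (E_sigma : sigma_exceptional sigma E) (E_full : full_collection E) :
  ((forall i j : 'I_n.+1, nat_of_ord j = (nat_of_ord i).+1 ->
      phase sigma (E i) < phase sigma (E j)) ->
   derived_points_ss sigma = [set generated [set E i] | i in setT] /\
   forall l : nat,
     stable_curves sigma (Posz l) = semistable_curves sigma (Posz l) /\
     semistable_curves sigma (Posz l) = set0)
  /\
  (forall (i j : 'I_n.+1) (l : nat),
     nat_of_ord j = (nat_of_ord i).+1 ->
     homdim 1 (E i) (E j) l.+1 ->
     (forall k : int, k != 1 -> homdim k (E i) (E j) 0) ->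
     phase sigma (E j) <= phase sigma (E i) ->
     stable_curves sigma (Posz l) (generated [set E i; E j])).
Proof.
split=> [E_step|i j l ij hom1 homk E_phase]; last exact: pair_stable_curve.
have E_inc : {homo (phase sigma \o E) : i j / (i < j)%N >-> i < j}.
  move=> i j /= ij; have [d jE] : exists d, nat_of_ord j = (i + d.+1)%N.
    by exists (j - i).-1; lia.
  elim: d j jE {ij} => [|d IH] j jE; first by apply: E_step; rewrite jE addn1.
  have lt : (i + d.+1 < n.+1)%N by have := ltn_ord j; rewrite jE; lia.
  apply: lt_trans (IH (Ordinal lt) erefl) _; apply: E_step.
  by rewrite jE /= addnS.
split; first exact: increasing_derived_points.
move=> l; rewrite (increasing_semistable_curves E_sigma E_full E_inc).
by split=> //; exact: (increasing_stable_curves E_sigma).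
Qed.
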